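(* For every Noetherian space $X$, $\mathrm{sob}(X^* ) = \omega^{||X||^\circ} + 1$ (equivalently, $\mathrm{rsob}(X^* ) = \omega^{||X||^\circ}$) if $X$ is non-empty, and $\mathrm{sob}(X^* ) = 1$ otherwise.
   Context: A topological space is Noetherian if every open subset is compact (every open cover has a finite subcover; no separation is required). For a well-founded poset $P$ and $x \in P$, $\mathrm{rk}_P(x) = \sup_{x' < x} (\mathrm{rk}_P(x')+1)$ and the ordinal rank of $P$ is $|P| = \sup_{x \in P} (\mathrm{rk}_P(x)+1)$, where $\sup\emptyset = 0$. $\mathcal{H}_0 X$ is the poset of all closed subsets of $X$ (including $\emptyset$), ordered by inclusion; it is well-founded when $X$ is Noetherian. The stature of a Noetherian space $X$ is $||X|| = |\mathcal{H}_0 X| - 1$, equivalently $||X|| = \mathrm{rk}_{\mathcal{H}_0 X}(X)$. A closed subset $C$ of $X$ is irreducible if it is non-empty and, whenever $C \subseteq F_1 \cup F_2$ with $F_1, F_2$ closed in $X$, we have $C \subseteq F_1$ or $C \subseteq F_2$. $\mathcal{S} X$ is the poset of irreducible closed subsets of $X$, ordered by inclusion. The sobrification rank of a Noetherian space $X$ is $\mathrm{sob}\, X = |\mathcal{S} X|$. When $X$ is non-empty, $\mathrm{sob}\, X$ is a successor ordinal and the reduced sobrification rank $\mathrm{rsob}\, X$ is $\mathrm{sob}\, X - 1$ (the ordinal whose successor is $\mathrm{sob}\, X$). $X^*$ is the set of finite words over $X$ (including the empty word) with the word topology: the topology generated by the subsets $X^* U_1 X^* U_2 X^* \cdots X^*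 U_n X^*$ (concatenation of sets of words), where $n \in \mathbb{N}$ and $U_1, \ldots, U_n$ are open subsets of $X$. $X^*$ is Noetherian when $X$ is. A critical ordinal is an ordinal $\epsilon$ such that $\epsilon = \omega^\epsilon$. For every ordinal $\alpha$, $\alpha^\circ$ is $\alpha + 1$ if $\alpha = \epsilon + n$ for some critical ordinal $\epsilon$ and some $n \in \mathbb{N}$, and $\alpha^\circ = \alpha$ otherwise. *)

(* Defs.v *)
From HB Require Import structures.
From mathcomp Require Import all_boot finmap.
From mathcomp Require Import boolp classical_sets topology.

Set Implicit Arguments.
Unset Strict Implicit.
Unset Printing Implicit Defensive.

Local Open Scope classical_set_scope.

(* Ordinals are well-founded trees considered up to [oeq]:
   [OSup f] stands for sup_i (f i + 1), the least ordinal strictly above every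
   [f i].  With this reading [ole] is the order on ordinals: a <= b iff every
   branch of [a] is <= some branch of [b]. *)
Inductive Ord : Type := OSup (A : Type) (f : A -> Ord).

Fixpoint ole (a b : Ord) {struct a} : Prop :=
  match a, b with
  | OSup A f, OSup B g => forall i, exists j, ole (f i) (g j)
  end.

Definition oeq (a b : Ord) : Prop := ole a b /\ ole b a.

Declare Scope Ord_scope.
Delimit Scope Ord_scope with Ord.
Notation "a == b" := (oeq a b) (at level 70, no associativity) : Ord_scope.

Definition odom (a : Ord) : Type := let: OSup A _ := a in A.
Definition obranch (a : Ord) : odom a -> Ord :=
  match a with OSup _ f => f end.

(* Least upper bound of a family: sup_i (f i), without the "+ 1". *)
Definition olub (I : Type) (f : I -> Ord) : Ord :=
  OSup (fun p : {i : I & odom (f i)} => obranch (projT2 p)).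

Definition ozero : Ord := OSup (fun v : void => match v with end).
Definition osucc (a : Ord) : Ord := OSup (fun _ : unit => a).
Definition onat (n : nat) : Ord := iter n osucc ozero.
Definition oomega : Ord := OSup onat.

(* The supremum of all b < a; this is the predecessor of [a] when [a] is a
   successor, the only case in which it is meant to be used. *)
Definition opred (a : Ord) : Ord := olub (@obranch a).

(* a + sup_j (b_j + 1) = max(a, sup_j ((a + b_j) + 1)) *)
Fixpoint oadd (a b : Ord) : Ord :=
  match b with
  | OSup B g =>
      OSup (fun k : odom a + B =>
        match k with inl i => obranch i | inr j => oadd a (g j) end)
  end.

(* a * sup_j (b_j + 1) = sup_j (a * b_j + a) *)
Fixpoint omul (a b : Ord) : Ord :=
  match b with OSup B g => olub (fun j => oadd (omul a (g j)) a) end.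

(* a ^ sup_j (b_j + 1) = max(1, sup_j (a ^ b_j * a)), for a > 0 *)
Fixpoint oexp (a b : Ord) : Ord :=
  match b with
  | OSup B g =>
      olub (fun k : option B =>
        match k with None => onat 1 | Some j => omul (oexp a (g j)) a end)
  end.

Definition critical (e : Ord) : Prop := (e == oexp oomega e)%Ord.

Definition ocirc (a : Ord) : Ord :=
  if pselect (exists e n, critical e /\ (a == oadd e (onat n))%Ord)
  then osucc a else a.

Section Rank.
Variables (P : Type) (lt : P -> P -> Prop).

Fixpoint rk_acc (x : P) (a : Acc lt x) {struct a} : Ord :=
  OSup (fun y : {y | lt y x} => rk_acc (Acc_inv a (proj2_sig y))).

Hypothesis wf : well_founded lt.

Definition rk (x : P) : Ord := rk_acc (wf x).
Definition ordinal_rank : Ord := OSup rk.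

End Rank.

Definition noetherian (X : topologicalType) : Prop :=
  forall U : set X, open U -> cover_compact U.

Definition closed_set (X : topologicalType) := {C : set X | closed C}.

Definition irreducible (X : topologicalType) (C : set X) : Prop :=
  C !=set0 /\
  forall F1 F2 : set X, closed F1 -> closed F2 ->
    C `<=` F1 `|` F2 -> C `<=` F1 \/ C `<=` F2.

Definition irr_closed_set (X : topologicalType) :=
  {C : set X | closed C /\ irreducible C}.

Definition closed_lt (X : topologicalType) (C D : closed_set X) : Prop :=
  sval C `<` sval D.

Definition irr_closed_lt (X : topologicalType) (C D : irr_closed_set X) : Prop :=
  sval C `<` sval D.

Lemma wf_no_descending (T : Type) (R : T -> T -> Prop) :
  (forall f : nat -> T, exists n, ~ R (f n.+1) (f n)) -> well_founded R.
Proof.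
move=> H x; apply: contrapT => nx.
have step (y : {y | ~ Acc R y}) : {z : {z | ~ Acc R z} | R (sval z) (sval y)}.
  apply: cid; case: y => y ny /=; apply: contrapT => nz.
  apply: ny; constructor => z Rzy; apply: contrapT => naz.
  by apply: nz; exists (exist _ z naz).
have [f [_ fS]] := dependent_choice step (exist _ x nx).
by have [n] := H (fun n => sval (f n)); apply.
Qed.

Lemma closed_lt_wf (X : topologicalType) :
  noetherian X -> well_founded (@closed_lt X).
Proof.
move=> hX; apply: wf_no_descending => f; apply: contrapT => nf.
have {}nf n : sval (f n.+1) `<` sval (f n).
  by apply: contrapT => h; apply: nf; exists n.
have dec m n : m <= n -> sval (f n) `<=` sval (f m).
  elim: n => [|n IH]; first by rewrite leqn0 => /eqP ->.
  rewrite leq_eqVlt => /orP[/eqP -> //|]; rewrite ltnS => /IH; apply: subset_trans.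
  by have [] := nf n.
have ofn n : open (~` sval (f n)) by apply: closed_openC; exact: (proj2_sig (f n)).
have oU : open (\bigcup_(n in setT) ~` sval (f n)) by exact: bigcup_open.
have [D _ cD] := hX _ oU nat setT (fun n => ~` sval (f n))
  (fun n _ => ofn n) (@subset_refl _ _).
pose N := \max_(i <- finmap.enum_fset D) i.
have [_] := nf N; apply => x fx; apply: contrapT => nx.
have [|i /= iD] := cD x; first by exists N.+1.
by apply; apply: dec fx; apply: (@leq_bigmax_seq _ _ xpredT id).
Qed.

Lemma irr_closed_lt_wf (X : topologicalType) :
  noetherian X -> well_founded (@irr_closed_lt X).
Proof.
move=> hX; apply: wf_no_descending => f; apply: contrapT => nf.
pose g n : closed_set X := exist _ (sval (f n)) (proj1 (proj2_sig (f n))).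
suff: ~ Acc (@closed_lt X) (g 0%N) by apply; exact: closed_lt_wf.
move: {2}(g 0%N) (erefl (g 0%N)) => c gc ac; rewrite gc in ac.
move: 0%N gc; elim: ac => {}c _ IH n gc; apply: (IH (g n.+1) _ n.+1 erefl).
by rewrite -gc /closed_lt /=; apply: contrapT => h; apply: nf; exists n.
Qed.

Definition stature (X : topologicalType) (hX : noetherian X) : Ord :=
  opred (ordinal_rank (closed_lt_wf hX)).

Definition sob (X : topologicalType) (hX : noetherian X) : Ord :=
  ordinal_rank (irr_closed_lt_wf hX).

Definition rsob (X : topologicalType) (hX : noetherian X) : Ord :=
  opred (sob hX).

Definition words (X : Type) : Type := seq X.

Definition catset (X : Type) (A B : set (words X)) : set (words X) :=
  [set a ++ b | a in A & b in B].

Definition letters (X : Type) (U : set X) : set (words X) :=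
  [set [:: x] | x in U].

(* The set of words X^* U_1 X^* U_2 X^* ... U_n X^*. *)
Fixpoint wordset (X : Type) (us : seq (set X)) : set (words X) :=
  match us with
  | [::] => setT
  | U :: us' => catset setT (catset (letters U) (wordset us'))
  end.

Definition all_open (X : topologicalType) (us : seq (set X)) : Prop :=
  foldr (fun U P => open U /\ P) True us.

HB.instance Definition _ (X : topologicalType) := Choice.copy (words X) (seq X).
HB.instance Definition _ (X : topologicalType) :=
  @isSubBaseTopological.Build (words X) (set (words X))
    [set wordset us | us in @all_open X] id.

Lemma wordset_consE (X : Type) (U : set X) us (w : words X) :
  wordset (U :: us) w <->
  exists p x q, [/\ w = p ++ x :: q, U x & wordset us q].
Proof.
split=> [[p _ [_ [_ [x Ux <-] [q uq <-]] <-]]|[p [x [q [-> Ux uq]]]]].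
  by exists p, x, q.
exists p => //; exists (x :: q) => //.
by exists [:: x]; [exists x | exists q].
Qed.

Lemma wordset_cons_cons (X : Type) (U : set X) us x (w : words X) :
  wordset (U :: us) (x :: w) <->
  (U x /\ wordset us w) \/ wordset (U :: us) w.
Proof.
rewrite !wordset_consE; split=> [[[|y p] [z [q []]]]|].
- by case=> <- -> ? ?; left.
- by case=> _ -> ? ?; right; exists p, z, q.
case=> [[Ux uw]|[p [z [q [-> ? ?]]]]]; first by exists [::], x, w.
by exists (x :: p), z, q.
Qed.

Lemma wordset_cat (X : Type) us (p w : words X) :
  wordset us w -> wordset us (p ++ w).
Proof.
case: us => // U us; rewrite !wordset_consE => -[p' [x [q [-> Ux uq]]]].
by exists (p ++ p'), x, q; rewrite catA.
Qed.

Lemma wordset_meet (X : topologicalType) us vs (w : words X) :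
  all_open us -> all_open vs -> wordset us w -> wordset vs w ->
  exists ws, [/\ all_open ws, wordset ws w &
    wordset ws `<=` wordset us `&` wordset vs].
Proof.
elim: w us vs => [|x w IH] [|U us] [|V vs] ou ov uw vw.
all: try by [exists [::]; split].
all: try by [exists (V :: vs); split].
all: try by [exists (U :: us); split].
- by move/wordset_consE: uw => [[|? ?] [? [? []]]].
case: (ou) => oU ous; case: (ov) => oV ovs.
move/wordset_cons_cons: uw => [[Ux uw]|uw];
    move/wordset_cons_cons: vw => [[Vx vw]|vw].
- have [ws [ows www sub]] := IH us vs ous ovs uw vw.
  exists ((U `&` V) :: ws); split; first by split=> //; exact: openI.
    by apply/wordset_cons_cons; left.
  move=> z /wordset_consE [p [y [q [-> [Uy Vy] /sub [uq vq]]]]].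
  by split; apply/wordset_consE; exists p, y, q.
- have [ws [ows www sub]] := IH us (V :: vs) ous ov uw vw.
  exists (U :: ws); split=> //; first by apply/wordset_cons_cons; left.
  move=> z /wordset_consE [p [y [q [-> Uy /sub [uq vq]]]]].
  split; first by apply/wordset_consE; exists p, y, q.
  by rewrite -cat_rcons; exact: wordset_cat.
- have [ws [ows www sub]] := IH (U :: us) vs ou ovs uw vw.
  exists (V :: ws); split=> //; first by apply/wordset_cons_cons; left.
  move=> z /wordset_consE [p [y [q [-> Vy /sub [uq vq]]]]].
  split; last by apply/wordset_consE; exists p, y, q.
  by rewrite -cat_rcons; exact: wordset_cat.
- have [ws [ows www sub]] := IH (U :: us) (V :: vs) ou ov uw vw.
  by exists ws; split=> //; rewrite -cat1s; exact: wordset_cat.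
Qed.

Lemma open_words_base (X : topologicalType) (O : set (words X)) w :
  open O -> O w ->
  exists us, [/\ all_open us, wordset us w & wordset us `<=` O].
Proof.
move=> [D' sD <-] [A DA Aw].
suff [us [ous uw sub]] :
    exists us, [/\ all_open us, wordset us w & wordset us `<=` A].
  by exists us; split=> //; apply: (subset_trans sub) => z Az; exists A.
have [F sF AE] := sD _ DA; rewrite -AE in Aw *.
have {sF AE} : forall B, B \in finmap.enum_fset F ->
    exists2 us, all_open us & wordset us = B.
  by move=> B BF; have := sF B BF; rewrite inE => -[us ? <-]; exists us.
have : forall B, B \in finmap.enum_fset F -> B w by move=> B; exact: Aw.
rewrite (_ : \bigcap_(i in _) _ =
    [set z | forall B, B \in finmap.enum_fset F -> B z]); last by [].
elim: (finmap.enum_fset F) => [|B s IH] sw sb; first by exists [::]; split.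
have [|B0 B0s|us [ous uw sub]] := IH.
- by move=> B0 B0s; apply: sw; rewrite inE B0s orbT.
- by apply: sb; rewrite inE B0s orbT.
have [vs ovs vE] := sb B (mem_head _ _).
have [|ws [ows www wsub]] := wordset_meet ous ovs uw.
  by rewrite vE; apply: sw; rewrite mem_head.
exists ws; split=> // z /wsub [uz vz] B1; rewrite inE => /orP[/eqP ->|B1s].
  by rewrite -vE.
exact: (sub z uz).
Qed.

Lemma noetherian_subseq (X : topologicalType) (x : nat -> X)
    (U : nat -> set X) :
  noetherian X -> (forall n, open (U n)) -> (forall n, U n (x n)) ->
  exists s : nat -> nat, (forall j k, j < k -> s j < s k) /\
    (forall j k, j < k -> U (s j) (x (s k))).
Proof.
move=> hX oU Ux.
pose inf (F : closed_set X) := forall N, exists n, N <= n /\ sval F (x n).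
have [F infF minF] : exists2 F, inf F & forall G, closed_lt G F -> ~ inf G.
  have : inf (exist _ setT closedT) by move=> N; exists N.
  move: (exist _ setT closedT : closed_set X) => F0.
  elim: (closed_lt_wf hX F0) => {}F0 _ IH inf0.
  have [[G GF iG]|h] := pselect (exists2 G, closed_lt G F0 & inf G).
    exact: IH GF iG.
  by exists F0 => // G GF iG; apply: h; exists G.
have [g gP] := choice (fun N => infF N : exists n, N <= n /\ sval F (x n)).
have thr n : exists M, sval F (x n) -> forall m, M <= m -> sval F (x m) -> U n (x m).
  have [Fn|nF] := pselect (sval F (x n)); last by exists 0.
  have cG : closed (sval F `&` ~` U n).
    by apply: closedI; [exact: (proj2_sig F) | exact: open_closedC].
  have /minF/existsNP[M MP] : closed_lt (exist _ _ cG : closed_set X) F.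
    by split=> [z []//|]; move=> /(_ _ Fn) [_]; apply.
  exists M => _ m Mm Fm; apply: contrapT => nU.
  by apply: MP; exists m.
have {thr} [T TP] := choice thr.
pose B := fix B k := if k is k'.+1 then
  maxn (B k') (maxn (g (B k')).+1 (T (g (B k')))) else 0.
have Bmono j k : j <= k -> B j <= B k.
  elim: k => [|k IH]; first by rewrite leqn0 => /eqP ->.
  rewrite leq_eqVlt => /orP[/eqP -> //|]; rewrite ltnS => /IH h.
  by apply: leq_trans h _; exact: leq_maxl.
have gB j k : j < k -> maxn (g (B j)).+1 (T (g (B j))) <= g (B k).
  move=> jk; apply: leq_trans (proj1 (gP (B k))).
  by apply: leq_trans (Bmono _ _ jk); exact: leq_maxr.
exists (fun k => g (B k)); split=> j k /gB; rewrite geq_max => /andP[// h1 h2].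
by apply: TP => //; exact: (proj2 (gP _)).
Qed.

Definition bad_seq (X : topologicalType) (u : nat -> seq (set X)) : Prop :=
  forall n, all_open (u n) /\
    exists2 w, wordset (u n) w & forall m, m < n -> ~ wordset (u m) w.

Lemma no_bad_seq (X : topologicalType) (u : nat -> seq (set X)) :
  noetherian X -> ~ bad_seq u.
Proof.
move=> hX bu.
pose ext (p : seq (seq (set X))) := exists2 v, @bad_seq X v & mkseq v (size p) = p.
have step p : exists us : seq (set X), ext p ->
    ext (rcons p us) /\
    forall vs, ext (rcons p vs) -> size us <= size vs.
  have [[v bv vp]|np] := pselect (ext p); last by exists [::].
  have ev : exists n, `[< exists2 us, ext (rcons p us) & size us = n >].
    exists (size (v (size p))); apply/asboolP; exists (v (size p)) => //.
    by exists v => //; rewrite size_rcons mkseqS vp.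
  case: (ex_minnP ev) => n /asboolP[us eus un] min.
  exists us => _; split=> // vs evs; rewrite un; apply: min.
  by apply/asboolP; exists vs.
have {step} [pick pickP] := choice step.
pose l := fix l n := if n is n'.+1 then rcons (l n') (pick (l n')) else [::].
have el n : ext (l n).
  elim: n => [|n IH]; first by exists u.
  by have [] := pickP _ IH.
pose t n := pick (l n).
have lE n : l n = mkseq t n by elim: n => [//|n IH]; rewrite mkseqS -IH.
have tE n v : mkseq v n = l n -> forall m, m < n -> v m = t m.
  move=> vE m mn; have := congr1 (nth [::] ^~ m) vE.
  by rewrite lE !nth_mkseq.
have bt : bad_seq t.
  move=> n; have [v bv] := el n.+1; rewrite lE size_mkseq -lE => vE.
  have [ov [w vw wP]] := bv n; rewrite -(tE _ _ vE n)//; split=> //.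
  by exists w => // m mn; rewrite -(tE _ _ vE m) ?ltnS 1?ltnW//; exact: wP.
have tmin v n : bad_seq v -> (forall m, m < n -> v m = t m) ->
    size (t n) <= size (v n).
  move=> bv vt; have [_] := pickP _ (el n); apply.
  exists v => //; rewrite size_rcons mkseqS lE size_mkseq.
  by congr rcons; apply: (@eq_from_nth _ [::]) => [|i];
    rewrite size_mkseq ?size_mkseq // => ilt; rewrite !nth_mkseq// vt.
have dec n : exists c : set X * seq (set X) * (words X * X * words X),
    [/\ t n = c.1.1 :: c.1.2, c.1.1 c.2.1.2, wordset c.1.2 c.2.2 &
      forall m, m < n -> ~ wordset (t m) (c.2.1.1 ++ c.2.1.2 :: c.2.2)].
  case E: (t n) => [|U us].
    have [_ [w _ /(_ n (ltnSn n))]] := bt n.+1.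
    by rewrite E; case.
  have [_ [w]] := bt n; rewrite E => /wordset_consE[p [x [q [-> Ux uq]]]] wP.
  by exists (U, us, (p, x, q)).
have {dec} [c cP] := choice dec.
have oc n : open (c n).1.1 /\ all_open (c n).1.2.
  by have [ot _] := bt n; have [E _ _ _] := cP n; move: ot; rewrite E.
have [|n|s [smono sP]] := @noetherian_subseq X (fun n => (c n).2.1.2)
    (fun n => (c n).1.1) hX.
- by move=> n; have [] := oc n.
- by have [] := cP n.
have sge k : s 0 <= s k by case: k => // k; apply: ltnW; exact: smono.
pose r i := if i < s 0 then t i else (c (s (i - s 0))).1.2.
have br : bad_seq r.
  move=> n; rewrite /r; case: ltnP => [ns|sn].
    have [ot [w tw wP]] := bt n; split=> //; exists w => // m mn.
    by rewrite (ltn_trans mn ns); exact: wP.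
  have [_ oc2] := oc (s (n - s 0)); split=> //.
  have [tE' Ux uq nw] := cP (s (n - s 0)).
  exists (c (s (n - s 0))).2.2 => // m mn; case: ltnP => [ms|sm] mw.
    apply: (nw m); first exact: leq_trans ms (sge _).
    by rewrite -cat_rcons; exact: wordset_cat.
  have lt : m - s 0 < n - s 0 by rewrite ltn_sub2r// (leq_ltn_trans sm).
  apply: (nw (s (m - s 0))); first exact: smono.
  have [-> _ _ _] := cP (s (m - s 0)).
  by apply/wordset_consE; do 3 eexists; split; [reflexivity|exact: sP|].
have := tmin r (s 0) br; rewrite /r ltnn subnn.
have [-> _ _ _] := cP (s 0); rewrite ltnn => h.
by suff: false by []; apply: h => m ->.
Qed.

Lemma noetherian_words (X : topologicalType) :
  noetherian X -> noetherian (words X : topologicalType).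
Proof.
move=> hX O oO I D f of_ Of; apply: contrapT => nfin.
pose P us := all_open us /\ exists2 i, D i & wordset us `<=` f i.
have step (l : seq (seq (set X))) : exists us, (forall vs, vs \in l -> P vs) ->
    P us /\ exists2 w, wordset us w & forall vs, vs \in l -> ~ wordset vs w.
  have [lP|] := pselect (forall vs, vs \in l -> P vs); last by exists [::].
  have [[w Ow wl]|nw] :=
      pselect (exists2 w, O w & forall vs, vs \in l -> ~ wordset vs w).
    have [i Di fiw] := Of _ Ow.
    have [us [ous uw usub]] := open_words_base (of_ _ Di) fiw.
    by exists us => _; split; [split=> //; exists i | exists w].
  exfalso; apply: nfin.
  have [[w0 Ow0]|nO] := pselect (O !=set0); last first.
    by exists fset0 => // w Ow; case: nO; exists w.
  have [i0 _ _] := Of _ Ow0.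
  have idx vs : exists i, vs \in l -> D i /\ wordset vs `<=` f i.
    have [vl|] := pselect (vs \in l); last by exists i0.
    by have [_ [i Di sub]] := lP _ vl; exists i.
  have [h hP] := choice idx.
  exists [fset h vs | vs in l]%fset.
    by move=> _ /imfsetP[vs /= vl ->]; rewrite inE; have [] := hP _ vl.
  move=> w Ow; have [vs vl vw] : exists2 vs, vs \in l & wordset vs w.
    apply: contrapT => nvs; apply: nw; exists w => // vs vl vw.
    by apply: nvs; exists vs.
  exists (h vs); first by rewrite /= in_imfset.
  by have [_] := hP _ vl; apply.
have {step} [pick pickP] := choice step.
pose l := fix l n := if n is n'.+1 then pick (l n') :: l n' else [::].
have lP n : forall vs, vs \in l n -> P vs.
  elim: n => [//|n IH] vs; rewrite inE => /orP[/eqP ->|]; last exact: IH.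
  by have [] := pickP _ IH.
have lin m n : m < n -> pick (l m) \in l n.
  elim: n => [//|n IH]; rewrite ltnS leq_eqVlt inE => /orP[/eqP ->|/IH ->].
    by rewrite eqxx.
  by rewrite orbT.
apply: (@no_bad_seq X (fun n => pick (l n)) hX) => n.
have [[ous _] [w uw wP]] := pickP _ (lP n); split=> //.
by exists w => // m mn; apply: wP; exact: lin.
Qed.

(* Main.v *)
Require Import Defs.
From mathcomp Require Import all_boot boolp classical_sets topology.

(** The space of words is itself irreducible, so the theorem computes the rank
    of X^* among the irreducible closed sets of words.  For a closed subset F of
    X, let ||F|| be its rank among the closed sets, and F^* the set of words
    over F; the rank of F^* turns out to be omega ^ (||F||°) for every non-empty F.

    Upper bound.  Give the product of atoms e_1 ... e_n, each of the form G^? or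
    F^* with G and F closed, the Hessenberg sum of the weights of its atoms:
    ||G|| for G^? and omega ^ (||F||°) for F^*.  If Q is irreducible, closed and
    strictly contained in a product, it misses a basic open set
    X^* U_1 X^* ... U_n X^* that meets the product.  What remains of the product
    is covered by finitely many products of smaller weight ([product_avoid]), and
    Q, being irreducible, lies in one of them.  The only arithmetic needed is
    that powers of omega are closed under Hessenberg sums ([wexp_closed]) and
    that ||F|| < omega ^ (||F||°) ([lt_wexp_ocirc]); the latter is what would
    fail at critical ordinals without the shift.  Hence the rank is at most the
    weight ([rk_le_weights]), and X^* is a product with one atom.

    Lower bound.  If G is a closed proper subset of F, choose x in F outside G
    and let C be the closure of x.  The powers of the block C^? G^* are contained
    in F^*, and each factor adds at least 1 + rk G^* to the rank, because in the
    words x^n w, with w in a single block and starting outside G, the letters x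
    must be read by different blocks.  So rk F^* is at least 1 + rk G^* times
    omega ([rk_star_lt]), and by induction all exponents that come from smaller
    closed sets are reached.  At a critical rank e = ||F|| one more exponent is
    needed.  The rank of a closed set is bounded by the Hessenberg sum of the
    omega ^ (rk C) over its irreducible components C ([rkH_le_wsum]), so that F
    contains an irreducible closed set C of rank at least e ([critical_irr]), and
    the powers of C^? give e * omega = omega ^ (e + 1) ([rk_star_irr]). *)

Set Implicit Arguments.
Unset Strict Implicit.
Unset Printing Implicit Defensive.

Local Open Scope classical_set_scope.

(** * The order on ordinals *)

Definition olt (a b : Ord) : Prop := exists j : odom b, ole a (obranch j).

Lemma oleP a b : ole a b <-> forall i : odom a, olt (obranch i) b.
Proof. by case: a => A f; case: b. Qed.

Lemma ole_refl a : ole a a.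
Proof. by elim: a => A f IH /= i; exists i. Qed.
#[local] Hint Resolve ole_refl : core.

Lemma ole_trans b a c : ole a b -> ole b c -> ole a c.
Proof.
elim: a b c => A f IH [B g] [C h] ab bc /= i.
have [j fg] := ab i; have [k gh] := bc j.
by exists k; exact: IH fg gh.
Qed.

Lemma ole_lt_trans b a c : ole a b -> olt b c -> olt a c.
Proof. by move=> ab [k bk]; exists k; exact: ole_trans ab bk. Qed.

Lemma olt_le_trans b a c : olt a b -> ole b c -> olt a c.
Proof. by move=> [j aj] /oleP /(_ j); exact: ole_lt_trans. Qed.

Lemma ole_ltP a b : ole a b <-> forall c, olt c a -> olt c b.
Proof.
split=> [ab c ca|h]; first exact: olt_le_trans ca ab.
by apply/oleP => i; apply: h; exists i.
Qed.

Lemma oltW a b : olt a b -> ole a b.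
Proof.
elim: a b => A f IH b [j /oleP ab]; apply/oleP => i; exists j.
exact/IH/ab.
Qed.

Lemma olt_trans b a c : olt a b -> olt b c -> olt a c.
Proof. by move=> /oltW; exact: ole_lt_trans. Qed.

Lemma olt_irr a : ~ olt a a.
Proof.
elim: a => A f IH [i /oleP /(_ i)] /= h.
exact: IH h.
Qed.

(** A branch [a_i] of [a] that is not below [b] lies above every branch of [b]:
    by induction [a_i] is comparable with each of them. *)
Lemma ole_total a b : ole a b \/ olt b a.
Proof.
elim: a b => A f IH b.
have [ab|nab] := pselect (forall i, olt (f i) b); first by left; apply/oleP.
have /existsNP[i nib] := nab; right; exists i; apply/oleP => j.
have [ij|//] := IH i (obranch j).
by case: nib; exists j.
Qed.

Lemma olt_zero a : ~ olt a ozero.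
Proof. by case=> -[]. Qed.

Lemma ole0 a : ole ozero a.
Proof. by apply/oleP; case. Qed.

Lemma olt_osucc a b : olt a (osucc b) <-> ole a b.
Proof. by split=> [[]|ab]; last exists tt. Qed.

Lemma ole_osucc a b : ole (osucc a) b <-> olt a b.
Proof. by split=> [/oleP/(_ tt)|ab]; last apply/oleP. Qed.

Lemma olt_olub (I : Type) (f : I -> Ord) c :
  olt c (olub f) <-> exists i, olt c (f i).
Proof.
split=> [[[i j] cj]|[i [j cj]]]; first by exists i, j.
by exists (existT _ i j).
Qed.

Lemma olub_le (I : Type) (f : I -> Ord) c :
  ole (olub f) c <-> forall i, ole (f i) c.
Proof.
split=> [/ole_ltP fc i|fc]; apply/ole_ltP => d df.
  by apply/fc/olt_olub; exists i.
by have [i /olt_le_trans] := iffLR (olt_olub f d) df; apply.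
Qed.

Lemma ole_olub (I : Type) (f : I -> Ord) i : ole (f i) (olub f).
Proof. by move: i; apply/olub_le. Qed.

Lemma opred_osucc a : (opred (osucc a) == a)%Ord.
Proof. by split; [apply/olub_le|exact: (@ole_olub unit (fun=> a) tt)]. Qed.

Lemma opred_le a b : ole a b -> ole (opred a) (opred b).
Proof.
move=> /oleP ab; apply/olub_le => i; have [j ij] := ab i.
exact: ole_trans ij (ole_olub _ j).
Qed.

(** * Ordinal sums *)

Lemma olt_oadd a b c :
  olt c (oadd a b) <->
  olt c a \/ exists j : odom b, ole c (oadd a (obranch j)).
Proof.
case: b => B g /=; split=> [[[i|j] h]|[[i h]|[j h]]].
- by left; exists i.
- by right; exists j.
- by exists (inl i).
- by exists (inr j).
Qed.

Lemma oadd_lel a b : ole a (oadd a b).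
Proof. by apply/ole_ltP => c ca; apply/olt_oadd; left. Qed.

Lemma oadd_le a a' b b' : ole a a' -> ole b b' -> ole (oadd a b) (oadd a' b').
Proof.
move=> aa'; elim: b b' => B g IH b' /oleP bb'; apply/ole_ltP => c /olt_oadd.
case=> [ca|[j cj]].
  by apply: olt_le_trans (oadd_lel _ _); exact: olt_le_trans ca aa'.
have [k jk] := bb' j; apply/olt_oadd; right; exists k.
exact: ole_trans cj (IH _ _ jk).
Qed.

Lemma oadd_ltr a b b' : olt b b' -> olt (oadd a b) (oadd a b').
Proof. by move=> [j bj]; apply/olt_oadd; right; exists j; exact: oadd_le. Qed.

Lemma oadd_ler a b : ole b (oadd a b).
Proof.
elim: b => B g IH; apply/oleP => j; apply/olt_oadd; right.
by exists j; exact: IH.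
Qed.

Lemma oadd0 a : ole (oadd a ozero) a.
Proof. by apply/ole_ltP => c /olt_oadd [|[[]]]. Qed.

Lemma oaddS a b : (oadd a (osucc b) == osucc (oadd a b))%Ord.
Proof.
split; last first.
  by apply/ole_osucc/oadd_ltr/olt_osucc.
apply/ole_ltP => c /olt_oadd [ca|[[] cb]]; apply/olt_osucc => //.
by apply: oltW; apply: olt_le_trans ca (oadd_lel _ _).
Qed.

(** * Products and powers of omega *)

Lemma omul_ltS a b d : olt d b -> ole (oadd (omul a d) a) (omul a b).
Proof.
suff mono b1 b2 : ole b1 b2 -> ole (omul a b1) (omul a b2).
  case: b => B g [j dj] /=; apply: ole_trans (ole_olub _ j).
  by apply: oadd_le => //; exact: mono.
elim: b1 b2 => B f IH [C g] h; apply/olub_le => i; have [j ij] := h i.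
by apply: ole_trans (ole_olub _ j); apply: oadd_le => //; exact: IH.
Qed.

Lemma olt_omul a b c :
  olt c (omul a b) -> exists2 d, olt d b & olt c (oadd (omul a d) a).
Proof.
case: b => B g /olt_olub [j cj]; exists (g j) => //.
by exists j.
Qed.

Lemma omul_le a a' b b' : ole a a' -> ole b b' -> ole (omul a b) (omul a' b').
Proof.
move=> aa'; elim: b b' => B g IH b' h; apply/olub_le => j.
have bj : olt (g j) b' by move/oleP : h; exact.
apply: ole_trans (omul_ltS a' bj).
by apply: oadd_le => //; exact: IH.
Qed.

Lemma omulS a b : (omul a (osucc b) == oadd (omul a b) a)%Ord.
Proof. by split; [apply/olub_le|apply: omul_ltS; apply/olt_osucc]. Qed.

Lemma olt_oomega n : olt (onat n) oomega.
Proof. by exists n. Qed.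

Lemma omul_oomega_le a t :
  (forall n, ole (omul a (onat n)) t) -> ole (omul a oomega) t.
Proof.
move=> h; apply/olub_le => n; apply: ole_trans (h n.+1).
exact: (omulS a (onat n)).2.
Qed.

Lemma olt_omul_oomega a c :
  olt c (omul a oomega) -> exists n, olt c (omul a (onat n)).
Proof.
move=> /olt_olub [n cn]; exists n.+1.
exact: olt_le_trans cn (omulS a (onat n)).2.
Qed.

Notation wexp := (oexp oomega).

Lemma wexp_ge1 c : ole (onat 1) (wexp c).
Proof. by case: c => C h; exact: (ole_olub _ None). Qed.

Lemma wexp_gt0 c : olt ozero (wexp c).
Proof. by apply/ole_osucc; exact: wexp_ge1. Qed.

Lemma wexp_lub c t : ole (onat 1) t ->
  (forall d, olt d c -> ole (omul (wexp d) oomega) t) -> ole (wexp c) t.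
Proof.
case: c => C h t1 ht; apply/olub_le => -[j|//].
by apply: ht; exists j.
Qed.

Lemma wexp_le a b : ole a b -> ole (wexp a) (wexp b).
Proof.
elim: a b => A f IH [B g] h; apply/olub_le => -[i|]; last exact: wexp_ge1.
have [j ij] := h i; apply: ole_trans (ole_olub _ (Some j)).
by apply: omul_le => //; exact: IH.
Qed.

Lemma wexp_ltS a b : olt a b -> ole (omul (wexp a) oomega) (wexp b).
Proof.
case: b => B g [j aj]; apply: ole_trans (ole_olub _ (Some j)).
by apply: omul_le => //; exact: wexp_le.
Qed.

Lemma omul1 a : ole a (omul a (onat 1)).
Proof. exact: ole_trans (oadd_ler _ _) (omulS a ozero).2. Qed.

Lemma wexp_lt a b : olt a b -> olt (wexp a) (wexp b).
Proof.
move=> /wexp_ltS; apply: olt_le_trans.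
apply: olt_le_trans (omul_ltS _ (olt_oomega 1)).
apply: ole_lt_trans (omul1 _) _.
apply: ole_lt_trans (oadd_lel _ ozero) _.
by apply: oadd_ltr; exact: wexp_gt0.
Qed.

(** A strictly increasing function on ordinals, here [wexp], is inflationary. *)
Lemma wexp_ge a : ole a (wexp a).
Proof.
elim: a => A f IH; apply/oleP => i; apply: ole_lt_trans (IH i) _.
by apply: wexp_lt; exists i.
Qed.

(** * Hessenberg sums *)

(** The Hessenberg (natural) sum: the least operation strictly increasing in
    both arguments.  It measures finite unions and products, where the parts
    can shrink independently of one another. *)
Fixpoint nsum (a : Ord) : Ord -> Ord :=
  match a with OSup A f =>
    fix nsum_a (b : Ord) : Ord :=
      match b with OSup B g =>
        OSup (fun k : A + B =>
          match k with inl i => nsum (f i) b | inr j => nsum_a (g j) end)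
      end
  end.

Lemma olt_nsum a b c :
  olt c (nsum a b) <->
  (exists i : odom a, ole c (nsum (obranch i) b)) \/
  (exists j : odom b, ole c (nsum a (obranch j))).
Proof.
case: a b => A f [B g] /=; split=> [[[i|j] h]|[[i h]|[j h]]].
- by left; exists i.
- by right; exists j.
- by exists (inl i).
- by exists (inr j).
Qed.

Lemma nsum_le a a' b b' : ole a a' -> ole b b' -> ole (nsum a b) (nsum a' b').
Proof.
elim: a a' b b' => A f IHa a' b; elim: b => B g IHb b' aa' bb'.
apply/ole_ltP => c /olt_nsum [[i ci]|[j cj]]; apply/olt_nsum.
  have [k ik] := iffLR (oleP _ _) aa' i; left; exists k.
  exact: ole_trans ci (IHa _ _ _ _ ik bb').
have [k jk] := iffLR (oleP _ _) bb' j; right; exists k.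
exact: ole_trans cj (IHb _ _ aa' jk).
Qed.

Lemma nsum_ltl a a' b : olt a a' -> olt (nsum a b) (nsum a' b).
Proof. by move=> [i ai]; apply/olt_nsum; left; exists i; exact: nsum_le. Qed.

Lemma nsum_ltr a b b' : olt b b' -> olt (nsum a b) (nsum a b').
Proof. by move=> [i bi]; apply/olt_nsum; right; exists i; exact: nsum_le. Qed.

Lemma nsumC a b : ole (nsum a b) (nsum b a).
Proof.
elim: a b => A f IHa; elim=> B g IHb.
apply/ole_ltP => c /olt_nsum [[i ci]|[j cj]]; apply/olt_nsum.
  by right; exists i; exact: ole_trans ci (IHa _ _).
by left; exists j; exact: ole_trans cj (IHb _).
Qed.

Lemma nsumA a b c : ole (nsum a (nsum b c)) (nsum (nsum a b) c).
Proof.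
elim: a b c => A f IHa b; elim: b => B g IHb; elim=> C h IHc.
apply/ole_ltP => d /olt_nsum [[i di]|[k dk]].
  apply: ole_lt_trans di _; apply: ole_lt_trans (IHa _ _ _) _.
  by do 2 apply: nsum_ltl; exists i.
have : olt (obranch k) (nsum (OSup g) (OSup h)) by exists k.
move=> /olt_nsum [[j kj]|[j kj]]; apply: ole_lt_trans dk _.
  apply: ole_lt_trans (nsum_le (ole_refl _) kj) _.
  apply: ole_lt_trans (IHb _ _) _.
  by apply: nsum_ltl; apply: nsum_ltr; exists j.
apply: ole_lt_trans (nsum_le (ole_refl _) kj) _.
apply: ole_lt_trans (IHc _) _.
by apply: nsum_ltr; exists j.
Qed.

Lemma nsumAr a b c : ole (nsum (nsum a b) c) (nsum a (nsum b c)).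
Proof.
apply: ole_trans (nsumC _ _) _; apply: ole_trans (nsumA _ _ _) _.
apply: ole_trans (nsumC _ _) _; apply: ole_trans (nsumA _ _ _) _.
exact: nsumC.
Qed.

Lemma nsum0 a : ole (nsum ozero a) a.
Proof.
elim: a => A f IH; apply/ole_ltP => c /olt_nsum [[[]]|[j cj]].
by exists j; exact: ole_trans cj (IH _).
Qed.

Lemma nsum_lel a b : ole a (nsum a b).
Proof.
elim: a => A f IH; apply/oleP => i; apply/olt_nsum; left.
by exists i; exact: IH.
Qed.

Lemma oadd_nsum a b : ole (oadd a b) (nsum a b).
Proof.
elim: b => B g IH; apply/ole_ltP => c /olt_oadd [ca|[j cj]].
  exact: olt_le_trans ca (nsum_lel _ _).
by apply/olt_nsum; right; exists j; exact: ole_trans cj (IH _).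
Qed.

Definition osum (s : seq Ord) : Ord := foldr nsum ozero s.

Lemma osum_cat s t : ole (osum (s ++ t)) (nsum (osum s) (osum t)).
Proof.
elim: s => [|a s IH] /=.
  exact: ole_trans (nsum_lel _ ozero) (nsumC _ _).
exact: ole_trans (nsum_le (ole_refl _) IH) (nsumA _ _ _).
Qed.

Definition nsum_closed (w : Ord) : Prop :=
  forall a b, olt a w -> olt b w -> olt (nsum a b) w.

(** On multiples of an ordinal that is closed under Hessenberg sums, the
    Hessenberg sum is no larger than the ordinary one.  This is how powers of
    omega, which are built with ordinary sums, inherit closure under [nsum]. *)
Section Multiples.
Variable w : Ord.
Hypotheses (w_gt0 : olt ozero w) (w_closed : nsum_closed w).

Let lt_mulS k a : olt a (omul w (onat k.+1)) ->
  exists2 d, olt d w & ole a (oadd (omul w (onat k)) d).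
Proof.
move=> /olt_le_trans/(_ (omulS w (onat k)).1)/olt_oadd[ak|[j aj]].
  by exists ozero => //; apply: ole_trans (oltW ak) (oadd_lel _ _).
by exists (obranch j) => //; exists j.
Qed.

(** An ordinal below [w * (k + 1)] has the form [w * k + d] with [d < w] up to
    majoration; [nsum d c] is then less than [w], and the case of [k] applies
    to it. *)
Lemma nsum_mul_lt k c : olt c w ->
  ole (nsum (omul w (onat k)) c) (oadd (omul w (onat k)) c).
Proof.
elim: k c => [|k IHk] c.
  move=> _; apply: ole_trans (oadd_ler _ c).
  apply: ole_trans (nsum0 c); apply: nsum_le => //.
  by apply/ole_ltP => d /olt_omul [e /olt_zero].
elim: c => C h IHc cw; apply/ole_ltP => d /olt_nsum [[i di]|[j dj]].
  apply: olt_le_trans (oadd_lel _ _); apply: ole_lt_trans di _.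
  have [|e ew ie] := @lt_mulS k (obranch i); first by exists i.
  apply: olt_le_trans (omulS w (onat k)).2.
  apply: ole_lt_trans (nsum_le ie (ole_refl _)) _.
  apply: ole_lt_trans (nsum_le (oadd_nsum _ _) (ole_refl _)) _.
  apply: ole_lt_trans (nsumAr _ _ _) _.
  have ecw : olt (nsum e (OSup h)) w by exact: w_closed.
  by apply: ole_lt_trans (IHk _ ecw) _; exact: oadd_ltr.
have jc : olt (obranch j) (OSup h) by exists j.
apply: ole_lt_trans dj _; apply: ole_lt_trans (IHc _ _) (oadd_ltr _ jc).
exact: olt_trans jc cw.
Qed.

Lemma nsum_mulS k :
  ole (nsum (omul w (onat k)) w) (omul w (onat k.+1)).
Proof.
elim: k => [|k IHk].
  apply: ole_trans (omul1 w); apply: ole_trans (nsum0 w).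
  by apply: nsum_le => //; apply/ole_ltP => d /olt_omul [e /olt_zero].
apply: ole_trans (omulS w (onat k.+1)).2.
have step e : olt e w -> olt (nsum (omul w (onat k.+1)) e)
    (oadd (omul w (onat k.+1)) w).
  by move=> ew; apply: ole_lt_trans (nsum_mul_lt _ ew) (oadd_ltr _ ew).
apply/ole_ltP => d /olt_nsum [[i di]|[j dj]]; apply: ole_lt_trans.
- exact: di.
- have [|e ew ie] := @lt_mulS k (obranch i); first by exists i.
  apply: ole_lt_trans (step _ ew).
  apply: ole_trans (nsumC _ _) _.
  apply: ole_trans (nsum_le (ole_refl w) ie) _.
  apply: ole_trans (nsum_le (ole_refl w) (oadd_nsum _ _)) _.
  apply: ole_trans (nsumA _ _ _) _; apply: nsum_le => //.
  exact: ole_trans (nsumC _ _) IHk.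
- exact: dj.
- by apply: step; exists j.
Qed.

Lemma nsum_mul k l :
  ole (nsum (omul w (onat k)) (omul w (onat l))) (omul w (onat (l + k))).
Proof.
elim: l => [|l IHl].
  apply: ole_trans (nsumC _ _) _; apply: ole_trans (nsum0 _).
  by apply: nsum_le => //; apply/ole_ltP => d /olt_omul [e /olt_zero].
apply: ole_trans (nsum_mulS (l + k)).
apply: ole_trans (nsum_le (ole_refl _) (omulS w (onat l)).1) _.
apply: ole_trans (nsum_le (ole_refl _) (oadd_nsum _ _)) _.
by apply: ole_trans (nsumA _ _ _) _; exact: nsum_le.
Qed.

End Multiples.

(** Two ordinals below [omega ^ c] lie below finite multiples of one smaller
    power, the larger of the two exponents being usable for both. *)
Lemma wexp_closed c : nsum_closed (wexp c).
Proof.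
elim: c => C h IH a b aw bw.
have split1 t : olt t (wexp (OSup h)) ->
    ole t ozero \/ exists j n, olt t (omul (wexp (h j)) (onat n)).
  move=> /olt_olub [[j|] tj]; [right|left]; last by apply/olt_osucc.
  by have [n tn] := olt_omul_oomega tj; exists j, n.
have [a0|[i [k ak]]] := split1 _ aw.
  apply: ole_lt_trans bw; apply: ole_trans (nsum0 b).
  exact: nsum_le.
have [b0|[j [l bl]]] := split1 _ bw.
  apply: ole_lt_trans aw; apply: ole_trans (nsumC _ _) _.
  by apply: ole_trans (nsum0 a); exact: nsum_le.
have [m [am bm]] : exists m, olt a (omul (wexp (h m)) (onat k)) /\
    olt b (omul (wexp (h m)) (onat l)).
  have [ij|/oltW ji] := ole_total (h i) (h j); [exists j|exists i].
    by split=> //; apply: olt_le_trans ak _; apply: omul_le => //; exact: wexp_le.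
  by split=> //; apply: olt_le_trans bl _; apply: omul_le => //; exact: wexp_le.
apply: olt_trans (nsum_ltl b am) _.
apply: olt_le_trans (nsum_ltr _ bm) _.
apply: ole_trans (nsum_mul (wexp_gt0 _) (@IH m) k l) _.
apply: ole_trans (ole_olub _ (Some m)); apply: omul_le => //.
exact/oltW/olt_oomega.
Qed.

(** * The shift above critical ordinals *)

Definition near_critical (a : Ord) : Prop :=
  exists e n, critical e /\ (a == oadd e (onat n))%Ord.

Lemma ocircT a : near_critical a -> ocirc a = osucc a.
Proof. by rewrite /ocirc; case: pselect. Qed.

Lemma ocircF a : ~ near_critical a -> ocirc a = a.
Proof. by rewrite /ocirc; case: pselect. Qed.

Lemma near_critical_eq a b :
  ole a b -> ole b a -> near_critical a -> near_critical b.
Proof.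
move=> ab ba [e [n [ce [h1 h2]]]]; exists e, n; split=> //.
by split; [exact: ole_trans ba h1|exact: ole_trans h2 ab].
Qed.

Lemma near_criticalS a : near_critical a -> near_critical (osucc a).
Proof.
move=> [e [n [ce [h1 h2]]]]; exists e, n.+1; split=> //.
have [s1 s2] := oaddS e (onat n); split.
  by apply: ole_trans s2; apply/oleP => -[] /=; apply/olt_osucc.
by apply: ole_trans s1 _; apply/oleP => -[] /=; apply/olt_osucc.
Qed.

Lemma ocirc_ge a : ole a (ocirc a).
Proof.
have [h|h] := pselect (near_critical a); last by rewrite ocircF.
by rewrite ocircT//; apply: oltW; apply/olt_osucc.
Qed.

(** Above [e + n] with [e] critical, an ordinal that is not shifted is at least
    [e + omega]: the successor of [e + n] is itself shifted. *)
Lemma ocirc_lt a b : olt a b -> olt (ocirc a) (ocirc b).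
Proof.
move=> ab; have [ha|ha] := pselect (near_critical a); last first.
  by rewrite (ocircF ha); exact: olt_le_trans ab (ocirc_ge b).
rewrite (ocircT ha); have [hb|hb] := pselect (near_critical b).
  by rewrite (ocircT hb); apply/olt_osucc/ole_osucc.
rewrite (ocircF hb); have [ba|//] := ole_total b (osucc a).
by case: hb; apply: near_critical_eq (near_criticalS ha) => //; apply/ole_osucc.
Qed.

Lemma ocirc_le a b : ole a b -> ole (ocirc a) (ocirc b).
Proof.
move=> ab; have [ba|/ocirc_lt/oltW//] := ole_total b a.
have [ha|ha] := pselect (near_critical a).
  rewrite (ocircT ha) (ocircT (near_critical_eq ab ba ha)).
  by apply/ole_osucc/olt_osucc.
by rewrite (ocircF ha) ocircF// => /(near_critical_eq ba ab).
Qed.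

(** If [a] is not below [wexp a] then the two are equal, so [a] is critical and
    the shift applies: this is what the shift is for in the upper bound. *)
Lemma lt_wexp_ocirc a : olt a (wexp (ocirc a)).
Proof.
have [ha|ha] := pselect (near_critical a).
  rewrite (ocircT ha); apply: ole_lt_trans (wexp_ge a) _.
  by apply: wexp_lt; apply/olt_osucc.
rewrite (ocircF ha); have [wa|//] := ole_total (wexp a) a.
case: ha; exists a, 0; split; first by split=> //; exact: wexp_ge.
by split; [exact: oadd_lel|exact: oadd0].
Qed.

Lemma ocirc0 : ocirc ozero = ozero.
Proof.
apply: ocircF => -[e [n [[_ ce] [_ h]]]]; apply: (@olt_zero ozero).
apply: olt_le_trans h; apply: olt_le_trans (oadd_lel _ _).
exact: olt_le_trans (wexp_gt0 _) ce.
Qed.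

(** * Ranks in well-founded relations *)

Section RankTheory.
Variables (P : Type) (lt : P -> P -> Prop) (wf : well_founded lt).

Lemma rk_lt x y : lt x y -> olt (rk wf x) (rk wf y).
Proof.
rewrite /rk; case: (wf y) => ay xy; exists (exist _ x xy).
by rewrite (Prop_irrelevance (wf x) (ay x xy)).
Qed.

Lemma olt_rk c y : olt c (rk wf y) -> exists2 x, lt x y & ole c (rk wf x).
Proof.
rewrite /rk; case: (wf y) => ay [[x xy] /= cx]; exists x => //.
by rewrite (Prop_irrelevance (wf x) (ay x xy)).
Qed.

Lemma rk_le y c : (forall x, lt x y -> olt (rk wf x) c) -> ole (rk wf y) c.
Proof.
move=> yc; apply/ole_ltP => d /olt_rk [x xy dx].
exact: ole_lt_trans dx (yc _ xy).
Qed.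

Lemma rk_homo x y : (forall z, lt z x -> lt z y) -> ole (rk wf x) (rk wf y).
Proof. by move=> xy; apply: rk_le => z /xy; exact: rk_lt. Qed.

End RankTheory.

(** A copy of the elements below [t], placed entirely above [p], raises the
    rank of its top to at least [rk p + 1 + rk t].  The predicate [D] cuts out
    the part of [T] on which [f] has to be strictly increasing. *)
Lemma rk_oadd_le (P T : Type) (lt : P -> P -> Prop) (ltT : T -> T -> Prop)
    (wf : well_founded lt) (wfT : well_founded ltT)
    (D : T -> Prop) (f : T -> P) (p : P) :
  (forall s t, D t -> ltT s t -> D s /\ lt (f s) (f t)) ->
  (forall t, D t -> lt p (f t)) ->
  forall t, D t ->
    ole (oadd (rk wf p) (oadd (onat 1) (rk wfT t))) (rk wf (f t)).
Proof.
move=> fS fp; elim/(well_founded_induction wfT) => t IH Dt.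
apply/ole_ltP => c /olt_oadd [cp|[j cj]].
  exact: olt_trans cp (rk_lt wf (fp _ Dt)).
have : olt (obranch j) (oadd (onat 1) (rk wfT t)) by exists j.
move=> /olt_oadd [/olt_osucc j0|[k jk]]; apply: ole_lt_trans cj _.
  apply: ole_lt_trans (oadd_le (ole_refl _) j0) _.
  exact: ole_lt_trans (oadd0 _) (rk_lt wf (fp _ Dt)).
have [s st ks] : exists2 s, ltT s t & ole (obranch k) (rk wfT s).
  by apply: olt_rk; exists k.
have [Ds fst] := fS s t Dt st.
apply: ole_lt_trans (rk_lt wf fst); apply: ole_trans (IH s st Ds).
by apply: oadd_le => //; apply: ole_trans jk (oadd_le _ _).
Qed.

(** * Irreducible sets *)

Section Irreducible.
Variable X : topologicalType.
Implicit Types (C F U V : set X).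

Lemma irreducible_meet C U V : irreducible C -> open U -> open V ->
  C `&` U !=set0 -> C `&` V !=set0 -> exists x, [/\ C x, U x & V x].
Proof.
move=> [_ irrC] oU oV [x [Cx Ux]] [y [Cy Vy]]; apply: contrapT => nUV.
have [|h|h] := irrC _ _ (open_closedC oU) (open_closedC oV).
- move=> z Cz; have [Uz|] := pselect (U z); [right|by left].
  by move=> Vz; apply: nUV; exists z.
- exact: h Cx Ux.
- exact: h Cy Vy.
Qed.

Lemma irreducible_closure1 (x : X) : irreducible (closure [set x] : set X).
Proof.
split; first by exists x; exact: subset_closure.
move=> F1 F2 cF1 cF2 /(_ x (@subset_closure _ [set x] x erefl)) xF.
have cl F : closed F -> F x -> closure [set x] `<=` F.
  by move=> cF Fx; rewrite closureE => y; apply; split=> // _ ->.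
by case: xF => /cl h; [left|right]; exact: h.
Qed.

Lemma irreducible_bigcup (I : finType) (f : I -> set X) C :
  irreducible C -> (forall i, closed (f i)) ->
  (forall x, C x -> exists i, f i x) -> exists i, C `<=` f i.
Proof.
move=> [[x0 Cx0] irrC] cf Cf.
suff H (s : seq I) : C `<=` \big[setU/set0]_(i <- s) f i ->
    exists i, C `<=` f i.
  apply: (H (enum I)) => x /Cf [i fx].
  by rewrite (bigD1_seq i) ?mem_enum ?enum_uniq//=; left.
elim: s => [|i s IH]; first by rewrite big_nil => /(_ _ Cx0).
rewrite big_cons => /irrC [||h|]; [exact: cf| |by exists i|exact: IH].
by apply: closed_bigsetU.
Qed.

End Irreducible.

(** * Closed sets as finite unions of irreducible closed sets *)

Section Decomposition.
Variables (X : topologicalType) (hX : noetherian X).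
Implicit Types (F G : closed_set X) (C D : irr_closed_set X).

Notation rkH := (rk (closed_lt_wf hX)).
Notation rkS := (rk (irr_closed_lt_wf hX)).

Lemma rkH_set0 F : sval F = set0 -> ole (rkH F) ozero.
Proof.
move=> F0; apply: rk_le => G [_]; rewrite F0; case.
by move=> x [].
Qed.

Lemma rkH_le F G : sval F `<=` sval G -> ole (rkH F) (rkH G).
Proof.
move=> FG; apply: rk_homo => K [KF FK]; split; first exact: subset_trans KF FG.
by move=> GK; apply: FK; exact: subset_trans FG GK.
Qed.

(** An upper bound on the rank, among closed sets, of the union of the [Cs]: the
    sum decreases strictly whenever the closed set to be covered shrinks. *)
Definition wsum (Cs : seq (irr_closed_set X)) : Ord :=
  osum [seq wexp (rkS C) | C <- Cs].

Definition union (Cs : seq (irr_closed_set X)) : set X :=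
  \big[setU/set0]_(C <- Cs) sval C.

(** Noetherian induction: a reducible closed set is the union of two smaller
    closed sets, and [wexp c] absorbs the sum of their bounds. *)
Lemma decompose F c :
  (forall C, sval C `<=` sval F -> olt (rkS C) c) ->
  exists2 Cs, sval F `<=` union Cs & olt (wsum Cs) (wexp c).
Proof.
elim/(well_founded_induction (closed_lt_wf hX)): F => F IH rkF.
have [F0|/set0P Fn0] := eqVneq (sval F) set0.
  by exists [::]; [rewrite F0|exact: wexp_gt0].
have [irrF|] := pselect (irreducible (sval F)).
  pose C : irr_closed_set X := exist _ (sval F) (conj (proj2_sig F) irrF).
  exists [:: C]; first by rewrite /union big_seq1.
  apply: wexp_closed; last exact: wexp_gt0.
  by apply: wexp_lt; exact: rkF.
move=> /not_andP [//|/existsNP [F1 /existsNP [F2]]].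
move=> /not_implyP [cF1 /not_implyP [cF2 /not_implyP [FF /not_orP [n1 n2]]]].
have half (F' : set X) (cF' : closed F') : ~ sval F `<=` F' ->
    exists2 Cs, sval F `&` F' `<=` union Cs & olt (wsum Cs) (wexp c).
  move=> nF'; pose G : closed_set X :=
    exist _ (sval F `&` F') (closedI (proj2_sig F) cF').
  apply: (IH G); first by split=> [x []//|h]; apply: nF' => x /h [].
  by move=> C CG; apply: rkF => x /CG [].
have [Cs FCs ltCs] := half _ cF1 n1; have [Ds FDs ltDs] := half _ cF2 n2.
exists (Cs ++ Ds).
  move=> x Fx; rewrite /union big_cat /=.
  by case: (FF _ Fx) => F'x; [left; exact: FCs|right; exact: FDs].
rewrite /wsum map_cat; apply: ole_lt_trans (osum_cat _ _) _.
exact: wexp_closed.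
Qed.

(** A component [C] that is not contained in [F] can be replaced by the
    components of [C `&` F], all of smaller rank than [C]; since [wexp (rkS C)]
    is closed under sums, their total stays below it. *)
Lemma wsum_shrink F Cs : ~ (union Cs `<=` sval F) ->
  exists2 Ds, sval F `&` union Cs `<=` union Ds & olt (wsum Ds) (wsum Cs).
Proof.
elim: Cs => [|C Cs IH]; first by rewrite /union big_nil => -[].
rewrite /union big_cons -/(union _) => nF.
have [CF|nCF] := pselect (sval C `<=` sval F).
  have [|Ds FDs ltDs] := IH; first by move=> h; apply: nF => x [/CF|/h].
  exists (C :: Ds); last exact: nsum_ltr.
  by rewrite /union big_cons => x [Fx [Cx|Csx]]; [left|right; exact: FDs].
pose K : closed_set X :=
  exist _ (sval C `&` sval F) (closedI (proj2_sig C).1 (proj2_sig F)).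
(* An irreducible [D] inside [K] differs from [C], so it has smaller rank. *)
have [|Ds KDs ltDs] := @decompose K (rkS C).
  move=> D DK; apply: rk_lt; split; first by move=> x /DK [].
  by move=> CD; apply: nCF => x /CD /DK [].
exists (Ds ++ Cs).
  rewrite /union big_cat => x [Fx [Cx|Csx]]; last by right.
  by left; apply: KDs.
rewrite /wsum map_cat; apply: ole_lt_trans (osum_cat _ _) _.
exact: nsum_ltl.
Qed.

Lemma rkH_le_wsum F Cs : sval F `<=` union Cs -> ole (rkH F) (wsum Cs).
Proof.
elim/(well_founded_induction (closed_lt_wf hX)): F Cs => F IH Cs FCs.
apply: rk_le => G GF; have [GF1 GF2] := GF.
have [|Ds GDs ltDs] := @wsum_shrink G Cs; first by move=> h; apply: GF2 => x /FCs/h.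
apply: ole_lt_trans ltDs; apply: IH => // x Gx.
by apply: GDs; split=> //; exact/FCs/GF1.
Qed.

(** If every irreducible [C] inside [F] had rank below [e = rkH F], then [F]
    would have rank below [wexp e = e].  So at critical ranks nothing is
    lost by counting irreducible closed subsets of [F] only, which is why the
    exponent has to be shifted there. *)
Lemma critical_irr F : critical (rkH F) ->
  exists2 C, sval C `<=` sval F & ole (rkH F) (rkS C).
Proof.
move=> [_ crit]; apply: contrapT => nC.
have [|Cs FCs ltCs] := @decompose F (rkH F).
  move=> C CF; have [FC|//] := ole_total (rkH F) (rkS C).
  by case: nC; exists C.
apply: (@olt_irr (wsum Cs)); apply: olt_le_trans ltCs _.
exact: ole_trans crit (rkH_le_wsum FCs).
Qed.

End Decomposition.

(** * Closed and irreducible sets of words *)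

Section Words.
Variable X : topologicalType.
Implicit Types (F G U : set X) (A B : set (words X)) (w z : words X).
Implicit Types (us vs : seq (set X)).

Lemma open_wordset us : all_open us -> open (wordset us).
Proof.
move=> ous; exists [set wordset us]; last by rewrite bigcup_set1.
by move=> _ ->; apply: (@finI_from1 _ _ _ id); exists us.
Qed.

Lemma closed_wordsP A :
  closed A <-> forall w, ~ A w ->
    exists us, [/\ all_open us, wordset us w & forall z, wordset us z -> ~ A z].
Proof.
split=> [cA w nAw|H]; first exact: open_words_base (closed_openC cA) nAw.
rewrite -[A]setCK; apply: open_closedC; rewrite openE => w /H [us [ous usw uA]].
by rewrite /interior nbhsE; exists (wordset us) => //; split=> //; exact: open_wordset.
Qed.

(** Basic open sets are stable under adding a prefix. *)
Lemma closed_suffix A z w : closed A -> A (z ++ w) -> A w.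
Proof.
move=> /closed_wordsP cA Azw; apply: contrapT => /cA [us [_ usw usA]].
by apply: usA Azw; exact: wordset_cat.
Qed.

Lemma closed_nil A w : closed A -> A w -> A [::].
Proof. by move=> cA; rewrite -{1}[w]cats0; exact: closed_suffix. Qed.

(** The factor [G^?] of word products. *)
Definition opt G : set (words X) :=
  fun w => match w with [::] => True | [:: x] => G x | _ => False end.

(** The factor [F^*] of word products. *)
Definition star F : set (words X) := fun w => forall x, x \in w -> F x.

Lemma star_cat F w z : star F (w ++ z) <-> star F w /\ star F z.
Proof.
split=> [h|[hw hz] x]; last by rewrite mem_cat => /orP[/hw|/hz].
by split=> x xw; apply: h; rewrite mem_cat xw ?orbT.
Qed.

Lemma star_cons F x w : star F (x :: w) <-> F x /\ star F w.
Proof.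
split=> [h|[Fx Fw] y]; last by rewrite inE => /orP[/eqP ->//|/Fw].
by split=> [|y yw]; apply: h; rewrite inE ?eqxx// yw orbT.
Qed.

Lemma opt_star G w : opt G w -> star G w.
Proof. by case: w => [|x [|]]//= Gx y; rewrite inE => /eqP ->. Qed.

Lemma catsetP A B w :
  catset A B w <-> exists a b, [/\ w = a ++ b, A a & B b].
Proof.
split=> [[a Aa [b Bb <-]]|[a [b [-> Aa Bb]]]]; first by exists a, b.
by exists a => //; exists b.
Qed.

Lemma catset_le A A' B B' :
  A `<=` A' -> B `<=` B' -> catset A B `<=` catset A' B'.
Proof.
by move=> AA BB _ [a /AA Aa [b /BB Bb <-]]; exists a => //; exists b.
Qed.

Lemma cat_eq_outside F a b p x q :
  a ++ b = p ++ x :: q -> star F a -> ~ F x -> exists p', b = p' ++ x :: q.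
Proof.
elim: a p => [|y a IH] p; first by move=> /= -> _ _; exists p.
case: p => [|z p] /= [e1 e2] /star_cons [Fy Fa] nFx; first by case: nFx; rewrite -e1.
exact: IH e2 Fa nFx.
Qed.

Lemma closed_nil1 : closed [set ([::] : words X)].
Proof.
apply/closed_wordsP => -[|x w] nw; [by case: nw|exists [:: setT]].
split; [by split=> //; exact: openT| |].
  by apply/wordset_consE; exists [::], x, w.
by move=> z /wordset_consE [p [y [q [-> _ _]]]]; case: p.
Qed.

(** A word outside [G^? A] has a basic neighbourhood avoiding it.  If the tail
    [w] is already outside [A], any letter in front of a neighbourhood of [w]
    works, since [A] is closed under suffixes.  Otherwise the first letter is
    not in [G], and the first open set of a neighbourhood avoiding [A] can be
    cut down to the complement of [G]: that letter must then be read by [A]. *)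
Lemma closed_opt_cat G A : closed G -> closed A -> closed (catset (opt G) A).
Proof.
move=> cG cA; apply/closed_wordsP => -[|x w] nGA.
  exists [::]; split=> // z _ /catsetP [a [b [_ _ /(closed_nil cA) A0]]].
  by apply: nGA; apply/catsetP; exists [::], [::].
have nA : ~ A (x :: w).
  by move=> Aw; apply: nGA; apply/catsetP; exists [::], (x :: w).
have [Aw|] := pselect (A w); last first.
  move=> /(iffLR (closed_wordsP _) cA) [us [ous usw usA]].
  exists (setT :: us); split; [by split=> //; exact: openT| |].
    by apply/wordset_cons_cons; left.
  move=> z /wordset_consE [p [y [q [-> _ usq]]]] /catsetP [a [b [e Ga Ab]]].
  apply: (usA q usq); case: a e Ga => [|g [|]] //= e _.
    by apply: (@closed_suffix A (p ++ [:: y])) => //; rewrite -catA /= e.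
  case: p e => [[_ ->//]|h p [_ e]].
  by apply: (@closed_suffix A (p ++ [:: y])) => //; rewrite -catA /= e.
have nGx : ~ G x.
  by move=> Gx; apply: nGA; apply/catsetP; exists [:: x], w.
have [us [ous usxw usA]] := iffLR (closed_wordsP _) cA _ nA.
case: us ous usxw usA => [|U us] ous usxw usA; first by case: (usA w).
move/wordset_cons_cons: usxw => [[Ux usw]|/usA//].
exists ((U `&` ~` G) :: us); split.
- by case: ous => oU ous; split=> //; apply: openI => //; exact: closed_openC.
- by apply/wordset_cons_cons; left.
move=> z /wordset_consE [p [y [q [-> [Uy nGy] usq]]]].
move=> /catsetP [a [b [/esym e /opt_star Ga Ab]]].
(* The letter [y] is not in [G], so it is read by [A] with all that follows. *)
have [p' eb] := cat_eq_outside e Ga nGy.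
apply: (usA (y :: q)); first by apply/wordset_cons_cons; left.
by apply: (@closed_suffix A p') => //; rewrite -eb.
Qed.

(** Letters of [F] in front do not matter.  Once the first letter [x] is outside
    [F], a neighbourhood of [x :: w] avoiding [A] is modified so that it first
    asks for a letter outside [F]; everything from that letter on is read by
    [A], whose suffixes are again in [A]. *)
Lemma closed_star_cat F A : closed F -> closed A -> closed (catset (star F) A).
Proof.
move=> cF cA; apply/closed_wordsP; elim=> [|x w IH] nFA.
  exists [::]; split=> // z _ /catsetP [a [b [_ _ /(closed_nil cA) A0]]].
  by apply: nFA; apply/catsetP; exists [::], [::].
have [Fx|nFx] := pselect (F x).
  have [|us [ous usw usFA]] := IH.
    move=> /catsetP [a [b [e Fa Ab]]]; apply: nFA; apply/catsetP.
    by exists (x :: a), b; rewrite e; split=> //; apply/star_cons.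
  by exists us; split=> //; exact: (@wordset_cat _ us [:: x]).
have nA : ~ A (x :: w).
  by move=> Aw; apply: nFA; apply/catsetP; exists [::], (x :: w).
have [us [ous usxw usA]] := iffLR (closed_wordsP _) cA _ nA.
have out V q : (forall y, V y -> ~ F y) ->
    (forall y, V y -> wordset us (y :: q)) ->
    forall p y, V y -> ~ catset (star F) A (p ++ y :: q).
  move=> VF Vus p y Vy /catsetP [a [b [/esym e Fa Ab]]].
  have [p' eb] := cat_eq_outside e Fa (VF _ Vy).
  apply: (usA (y :: q)); first exact: Vus.
  by apply: (@closed_suffix A p') => //; rewrite -eb.
case: us ous usxw usA out => [|U us] ous usxw usA out.
  by exists [::]; split=> // z _ /catsetP [a [b [_ _]]]; exact: usA.
move/wordset_cons_cons: usxw => [[Ux usw]|usw].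
  exists ((U `&` ~` F) :: us); split.
  - by case: ous => oU ous; split=> //; apply: openI => //; exact: closed_openC.
  - by apply/wordset_cons_cons; left.
  move=> z /wordset_consE [p [y [q [-> [Uy nFy] usq]]]].
  apply: (out (U `&` ~` F)) => // [t []//|t [Ut _]].
  by apply/wordset_cons_cons; left.
exists ((~` F) :: U :: us); split.
- by split=> //; exact: closed_openC.
- by apply/wordset_cons_cons; left.
move=> z /wordset_consE [p [y [q [-> nFy usq]]]].
apply: (out (~` F)) => // t _.
exact: (@wordset_cat _ (U :: us) [:: t]).
Qed.

Lemma closed_star F : closed F -> closed (star F).
Proof.
move=> cF; apply/closed_wordsP => w /existsNP [x /not_implyP [/splitPr xw nFx]].
case: xw => p q; exists [:: ~` F]; split.
- by split=> //; exact: closed_openC.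
- by apply/wordset_consE; exists p, x, q.
move=> z /wordset_consE [p' [y [q' [-> nFy _]]]] Fz.
by apply: nFy; apply: Fz; rewrite mem_cat inE eqxx orbT.
Qed.

Lemma closed_opt G : closed G -> closed (opt G).
Proof.
move=> cG; have := closed_opt_cat cG closed_nil1; congr closed.
apply/seteqP; split=> [w [a Ga [_ -> <-]]|w Gw]; first by rewrite cats0.
by apply/catsetP; exists w, [::]; rewrite cats0.
Qed.

Lemma wordset_split us w z : wordset us (w ++ z) ->
  exists us1 us2, [/\ us = us1 ++ us2, wordset us1 w & wordset us2 z].
Proof.
elim: w us => [|x w IH] us; first by exists [::], us.
case: us => [|U us]; first by exists [::], [::].
move=> /wordset_cons_cons [[Ux /IH [us1 [us2 [-> us1w us2z]]]]|].
  by exists (U :: us1), us2; split=> //; apply/wordset_cons_cons; left.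
move=> /IH [us1 [us2 [-> us1w us2z]]]; exists us1, us2; split=> //.
exact: (@wordset_cat _ us1 [:: x]).
Qed.

Lemma wordset_join us vs w z :
  wordset us w -> wordset vs z -> wordset (us ++ vs) (w ++ z).
Proof.
elim: us w => [|U us IH] w; first by move=> _; exact: wordset_cat.
move=> /wordset_consE [p [x [q [-> Ux usq]]]] vsz.
by apply/wordset_consE; exists p, x, (q ++ z); rewrite -catA; split=> //; exact: IH.
Qed.

Lemma all_open_cat us vs : all_open (us ++ vs) -> all_open us /\ all_open vs.
Proof.
by elim: us => [|U us IH] //= [oU /IH [? ?]].
Qed.

(** Irreducibility need only be tested on basic open sets. *)
Lemma irreducible_wordsP A :
  A !=set0 ->
  (forall us vs, all_open us -> all_open vs -> A `&` wordset us !=set0 ->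
    A `&` wordset vs !=set0 -> exists w, [/\ A w, wordset us w & wordset vs w]) ->
  irreducible A.
Proof.
move=> A0 H; split=> // F1 F2 /closed_wordsP cF1 /closed_wordsP cF2 AF.
apply: contrapT => /not_orP [/existsNP [w1 /not_implyP [Aw1 /cF1 [us [ous usw usF]]]]].
move=> /existsNP [w2 /not_implyP [Aw2 /cF2 [vs [ovs vsw vsF]]]].
have [||w [/AF [|] Fw usw' vsw']] := H us vs ous ovs.
- by exists w1.
- by exists w2.
- exact: usF Fw.
- exact: vsF Fw.
Qed.

Lemma irreducible_cat A B :
  irreducible A -> irreducible B -> irreducible (catset A B).
Proof.
move=> irrA irrB; apply: irreducible_wordsP.
  have [[a Aa] _] := irrA; have [[b Bb] _] := irrB.
  by exists (a ++ b); apply/catsetP; exists a, b.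
move=> us vs ous ovs [w1 [/catsetP [a1 [b1 [-> Aa1 Bb1]]] usw]].
move=> [w2 [/catsetP [a2 [b2 [-> Aa2 Bb2]]] vsw]].
have [us1 [us2 [eus usa usb]]] := wordset_split usw.
have [vs1 [vs2 [evs vsa vsb]]] := wordset_split vsw.
subst us vs; have [ous1 ous2] := all_open_cat ous.
have [ovs1 ovs2] := all_open_cat ovs.
have [||a [Aa ua va]] :=
  irreducible_meet irrA (open_wordset ous1) (open_wordset ovs1).
- by exists a1.
- by exists a2.
have [||b [Bb ub vb]] :=
  irreducible_meet irrB (open_wordset ous2) (open_wordset ovs2).
- by exists b1.
- by exists b2.
exists (a ++ b); split; [|exact: wordset_join..].
by apply/catsetP; exists a, b.
Qed.

Lemma irreducible_star F : irreducible (star F).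
Proof.
apply: irreducible_wordsP; first by exists [::].
move=> us vs _ _ [w [Fw usw]] [z [Fz vsz]]; exists (w ++ z).
split; first by apply/star_cat.
  by rewrite -[us]cats0; exact: wordset_join.
exact: wordset_cat.
Qed.

Lemma opt_wordset G us w : opt G w -> wordset us w ->
  us = [::] \/ exists x U, [/\ us = [:: U], w = [:: x], G x & U x].
Proof.
case: us => [|U us] Gw; first by left.
move=> /wordset_consE [p [x [q [e Ux usq]]]]; right; exists x, U.
case: p e => [|y p] e; last by move: Gw; rewrite e; case: p e.
move: Gw usq; rewrite e; case: q e => [|//] e Gx.
by case: us => [//|V us] /wordset_consE [p' [? [? []]]]; case: p'.
Qed.

Lemma irreducible_opt G : irreducible G -> irreducible (opt G).
Proof.
move=> irrG; apply: irreducible_wordsP; first by exists [::].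
move=> us vs ous ovs [w [Gw usw]] [z [Gz vsz]].
case: (opt_wordset Gw usw) ous => [-> _|[x [U [-> _ Gx Ux]]] [oU _]].
  by exists z.
case: (opt_wordset Gz vsz) ovs => [-> _|[y [V [-> _ Gy Vy]]] [oV _]].
  by exists [:: x]; split=> //; apply/wordset_cons_cons; left.
have [||t [Gt Ut Vt]] := irreducible_meet irrG oU oV; [by exists x|by exists y|].
by exists [:: t]; split=> //; apply/wordset_cons_cons; left.
Qed.

End Words.

(** * The rank of the whole space of words: upper bound *)

Section UpperBound.
Variables (X : topologicalType) (hX : noetherian X).
Implicit Types (F G : closed_set X) (us vs : seq (set X)).

Notation rkH := (rk (closed_lt_wf hX)).
Notation rkW := (rk (irr_closed_lt_wf (noetherian_words hX))).

(** Irreducible closed sets of words are measured by products of atoms [G^?] and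
    [F^*] containing them.  As these products only serve as upper bounds, [G]
    ranges over all closed sets, and the products need not be irreducible. *)
Inductive atom := Opt of closed_set X | Star of closed_set X.

Definition atom_set (a : atom) : set (words X) :=
  match a with Opt G => opt (sval G) | Star F => star (sval F) end.

Definition product_set (e : seq atom) : set (words X) :=
  foldr (fun a A => catset (atom_set a) A) [set [::]] e.

(** The weight of [G^?] counts closed subsets of [G] rather than irreducible
    ones.  It still lies below the weight of [G^*], by [lt_wexp_ocirc]. *)
Definition weight (a : atom) : Ord :=
  match a with Opt G => rkH G | Star F => wexp (ocirc (rkH F)) end.

Definition weights (e : seq atom) : Ord := osum (map weight e).

Lemma atom_nil a : atom_set a [::].
Proof. by case: a. Qed.

Lemma product_nil e : product_set e [::].
Proof.
elim: e => //= a e IH; apply/catsetP; exists [::], [::].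
by split=> //; exact: atom_nil.
Qed.

Lemma closed_product e : closed (product_set e).
Proof.
elim: e => [|[G|F] e IH] /=; first exact: closed_nil1.
  exact: closed_opt_cat (proj2_sig G) IH.
exact: closed_star_cat (proj2_sig F) IH.
Qed.

Lemma product_cat d e w z :
  product_set d w -> product_set e z -> product_set (d ++ e) (w ++ z).
Proof.
elim: d w => [|a d IH] w /=; first by move=> ->.
move=> /catsetP [b [c [-> ab dc]]] ez; apply/catsetP; exists b, (c ++ z).
by rewrite catA; split=> //; exact: IH.
Qed.

(** Finite covers, because an irreducible set covered by finitely many closed
    sets lies in one of them. *)
Definition covered (c : Ord) (A : set (words X)) : Prop :=
  exists (I : finType) (e : I -> seq atom),
    (forall i, olt (weights (e i)) c) /\
    forall w, A w -> exists i, product_set (e i) w.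

Lemma shrink_set F U : open U -> sval F `&` U !=set0 ->
  exists2 G, sval G = sval F `&` ~` U & olt (rkH G) (rkH F).
Proof.
move=> oU [x [Fx Ux]].
exists (exist _ _ (closedI (proj2_sig F) (open_closedC oU))) => //.
by apply: rk_lt; split=> [y []//|/(_ _ Fx) []].
Qed.

Lemma covered1 c A e : olt (weights e) c -> A `<=` product_set e -> covered c A.
Proof. by move=> ec Ae; exists unit, (fun=> e); split=> // w /Ae; exists tt. Qed.

(** The words over [F] outside [X^* U_1 X^* ... U_n X^*] are those for which
    looking greedily for a letter of [U_1], then of [U_2], and so on, fails.
    They all lie in
    [(F - U_1)^* F^? (F - U_2)^* F^? ... (F - U_n)^* F^?].
    Each [U_i] meets [F], so that [F - U_i] has smaller rank, and [wexp] of
    anything absorbs a finite sum of smaller weights. *)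
Lemma star_avoid F us : all_open us -> star (sval F) `&` wordset us !=set0 ->
  exists2 e, olt (weights e) (wexp (ocirc (rkH F))) &
    star (sval F) `&` ~` wordset us `<=` product_set e.
Proof.
elim: us => [|U us IH]; first by exists [::]; [exact: wexp_gt0|move=> w [_ []]].
move=> [oU ous] [w [Fw /wordset_consE [p [x [q [ew Ux usq]]]]]].
move: Fw; rewrite ew => /star_cat [_ /star_cons [Fx Fq]].
have [|e ltE coverE] := IH ous; first by exists q.
have [|G GE ltG] := @shrink_set F U oU; first by exists x.
exists [:: Star G, Opt F & e].
  apply: wexp_closed; first exact/wexp_lt/ocirc_lt.
  by apply: wexp_closed => //; exact: lt_wexp_ocirc.
elim=> [_|y z IHz [/star_cons [Fy Fz] nUz]]; first exact: product_nil.
(* The first letter in [U] is read by [F^?], the letters before it by [G^*]. *)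
have [Uy|nUy] := pselect (U y).
  apply/catsetP; exists [::], (y :: z); split=> //.
  apply/catsetP; exists [:: y], z; split=> //; apply: coverE; split=> // usz.
  by apply: nUz; apply/wordset_cons_cons; left.
have [|a [b [-> Ga Fb]]] := iffLR (catsetP _ _ z) (IHz _).
  by split=> // Uz; apply: nUz; apply/wordset_cons_cons; right.
apply/catsetP; exists (y :: a), b; split=> //; apply/star_cons.
by rewrite /= GE in Ga *.
Qed.

Lemma atom_avoid a us : all_open us -> atom_set a `&` wordset us !=set0 ->
  covered (weight a) (atom_set a `&` ~` wordset us).
Proof.
case: a => [G|F] ous meet; last first.
  have [e ltE coverE] := star_avoid ous meet.
  exact: covered1 ltE coverE.
have [w [Gw usw]] := meet.
case: (opt_wordset Gw usw) ous => [-> _|[x [U [-> _ Gx Ux]]] [oU _]].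
  by exists void, (fun=> [::]); split=> [[]|z [_ []]].
have [|K KE ltK] := @shrink_set G U oU; first by exists x.
apply: (@covered1 _ _ [:: Opt K]).
  by apply: ole_lt_trans ltK; exact: ole_trans (nsumC _ _) (nsum0 _).
move=> z [Gz nUz]; apply/catsetP; exists z, [::]; rewrite cats0; split=> //.
case: z Gz nUz => [//|y [|//]] Gy nUy; rewrite /= KE; split=> // Uy.
by apply: nUy; apply/wordset_cons_cons; left.
Qed.

(** A word of the product that lies in [wordset us] splits along the atoms, and
    [us] splits accordingly.  A word of the product outside [wordset us] must
    miss one of the two parts of [us] with its corresponding part, so one of
    the two factors can be replaced by something of smaller weight. *)
Lemma product_avoid e us : all_open us -> product_set e `&` wordset us !=set0 ->
  covered (weights e) (product_set e `&` ~` wordset us).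
Proof.
elim: e us => [|a e IH] us ous [w [ew usw]].
  exists void, (fun=> [::]); split=> [[]|z [/= -> nus]].
  by case: nus; rewrite -ew.
move: ew usw => /catsetP [b [c [-> ab ec]]] /wordset_split.
move=> [us1 [us2 [eus us1b us2c]]]; subst us.
have [ous1 ous2] := all_open_cat ous.
have [|I [f [fw fcov]]] := @atom_avoid a us1 ous1; first by exists b.
have [|J [g [gw gcov]]] := IH us2 ous2; first by exists c.
exists (I + J)%type, (fun k => match k with
  inl i => f i ++ e | inr j => a :: g j end).
split=> [[i|j]|z [/catsetP [p [q [-> ap eq]]] nus]].
- rewrite /weights map_cat; apply: ole_lt_trans (osum_cat _ _) _.
  exact: nsum_ltl (fw i).
- exact: nsum_ltr (gw j).
have [us1p|nus1p] := pselect (wordset us1 p); last first.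
  have [i fp] := fcov p (conj ap nus1p); exists (inl i).
  exact: product_cat.
have [us2q|nus2q] := pselect (wordset us2 q).
  by case: nus; exact: wordset_join.
have [j gq] := gcov q (conj eq nus2q); exists (inr j).
by apply/catsetP; exists p, q.
Qed.

(** Let [Q] be strictly below [P]. Some basic open set meets [P] and misses [Q],
    so [product_avoid] covers [Q] by finitely many lighter products; being
    irreducible, [Q] is contained in one of them. *)
Lemma rk_le_weights (P : irr_closed_set (words X)) e :
  sval P `<=` product_set e -> ole (rkW P) (weights e).
Proof.
elim/(well_founded_induction (irr_closed_lt_wf (noetherian_words hX))): P e.
move=> P IH e Pe; apply: rk_le => Q QP.
have [QsubP /existsNP [w /not_implyP [Pw nQw]]] := QP.
have [cQ irrQ] := proj2_sig Q.
have [us [ous usw usQ]] := iffLR (closed_wordsP _) cQ _ nQw.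
have [|I [f [fw fcov]]] := @product_avoid e us ous.
  by exists w; split=> //; exact: Pe.
have [||i Qi] := irreducible_bigcup (f := fun i => product_set (f i)) irrQ.
- by move=> i; exact: closed_product.
- by move=> z Qz; apply: fcov; split; [exact/Pe/QsubP|move=> /usQ].
exact: ole_lt_trans (IH Q QP _ Qi) (fw i).
Qed.

Lemma rk_words_le (P : irr_closed_set (words X)) (T : closed_set X) :
  sval T = setT -> ole (rkW P) (wexp (ocirc (rkH T))).
Proof.
move=> TE; apply: ole_trans (ole_trans (nsumC _ _) (nsum0 _)).
apply: (@rk_le_weights P [:: Star T]) => w _; apply/catsetP.
by exists w, [::]; rewrite cats0; split=> // x _; rewrite TE.
Qed.

End UpperBound.

(** * The rank of the whole space of words: lower bound *)

Section LowerBound.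
Variables (X : topologicalType) (hX : noetherian X).
Implicit Types (F G : closed_set X) (P Q : irr_closed_set (words X)).

Notation rkH := (rk (closed_lt_wf hX)).
Notation rkS := (rk (irr_closed_lt_wf hX)).
Notation rkW := (rk (irr_closed_lt_wf (noetherian_words hX))).

Lemma rkW_le P Q : sval P `<=` sval Q -> ole (rkW P) (rkW Q).
Proof.
move=> PQ; apply: rk_homo => K [KP PK]; split; first exact: subset_trans KP PQ.
by move=> QK; apply: PK; exact: subset_trans PQ QK.
Qed.

Definition starI F : irr_closed_set (words X) :=
  exist _ (star (sval F))
    (conj (closed_star (proj2_sig F)) (irreducible_star (sval F))).

Definition optI (C : irr_closed_set X) : irr_closed_set (words X) :=
  exist _ (opt (sval C)) (conj (closed_opt (proj2_sig C).1)
    (irreducible_opt (proj2_sig C).2)).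

Definition opt_catI (C : irr_closed_set X) P : irr_closed_set (words X) :=
  exist _ (catset (opt (sval C)) (sval P))
    (conj (closed_opt_cat (proj2_sig C).1 (proj2_sig P).1)
      (irreducible_cat (irreducible_opt (proj2_sig C).2) (proj2_sig P).2)).

Definition star_catI F P : irr_closed_set (words X) :=
  exist _ (catset (star (sval F)) (sval P))
    (conj (closed_star_cat (proj2_sig F) (proj2_sig P).1)
      (irreducible_cat (irreducible_star (sval F)) (proj2_sig P).2)).

Lemma irreducible_nil1 : irreducible [set ([::] : words X)].
Proof.
split; first by exists [::].
move=> F1 F2 _ _ /(_ [::] erefl) [] h; [left|right]; by move=> _ ->.
Qed.

Definition nilI : irr_closed_set (words X) :=
  exist _ [set [::]] (conj (@closed_nil1 X) irreducible_nil1).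

Lemma irr_nil P : sval P [::].
Proof. by have [cP [[w Pw] _]] := proj2_sig P; exact: closed_nil Pw. Qed.

(** The powers of the block [C^? G^*], for [x] in [C] outside [G]: the word
    [x ^ n] uses up [n] blocks, because a word in a single block has at most
    one letter outside [G]. *)
Section Powers.
Variables (C : irr_closed_set X) (G : closed_set X) (x : X).
Hypotheses (Cx : sval C x) (nGx : ~ sval G x).

Definition block P : irr_closed_set (words X) := opt_catI C (star_catI G P).

Definition outside (w : words X) : nat := count (fun y => ~~ `[< sval G y >]) w.

Lemma outside_star w : star (sval G) w -> outside w = 0.
Proof.
move=> Gw; apply/eqP; rewrite -leqn0 leqNgt -has_count; apply/hasP.
by move=> [y /Gw Gy /asboolP].
Qed.

Lemma outside_iter_block n k P :
  (forall w, sval P w -> outside w <= k) ->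
  forall w, sval (iter n block P) w -> outside w <= n + k.
Proof.
move=> Pk; elim: n => [|n IH] w /=; first exact: Pk.
move=> /catsetP [a [b [-> Ca /catsetP [c [d [-> Gc Pd]]]]]].
rewrite /outside !count_cat -!/(outside _) (outside_star Gc) add0n addSn -add1n.
apply: leq_add; last exact: IH.
by case: a Ca => [|y [|]] //= _; rewrite addn0; case: (~~ _).
Qed.

Lemma block_le P Q : sval P `<=` sval Q -> sval (block P) `<=` sval (block Q).
Proof. by move=> PQ; apply: catset_le => //; exact: catset_le. Qed.

Lemma iter_block_le n P Q : sval P `<=` sval Q ->
  sval (iter n block P) `<=` sval (iter n block Q).
Proof. by move=> PQ; elim: n => //= n IH; exact: block_le. Qed.

Lemma outside_block_nil w : sval (block nilI) w -> outside w <= 1.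
Proof. by apply: (@outside_iter_block 1 0) => {w} w /= ->. Qed.

Lemma iter_block_nseq n P w :
  sval P w -> sval (iter n block P) (nseq n x ++ w).
Proof.
move=> Pw; elim: n => //= n IH; apply/catsetP; exists [:: x], (nseq n x ++ w).
by split=> //; apply/catsetP; exists [::], (nseq n x ++ w).
Qed.

Lemma outside_nseq n y v : ~ sval G y -> n < outside (nseq n x ++ y :: v).
Proof.
move=> nGy; elim: n => [|n IH]; rewrite /outside /=.
  by case: asboolP.
by case: asboolP.
Qed.

(** Each of the first [n] blocks reads exactly one letter [x].  It cannot read
    two, and if it read none, then the blocks after it, with at most one letter
    outside [G] each, would be too few for the remaining letters [x] and [y]. *)
Lemma iter_block_cancel n P y v :
  sval P `<=` sval (block nilI) -> ~ sval G y ->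
  sval (iter n block P) (nseq n x ++ y :: v) -> sval P (y :: v).
Proof.
move=> PA nGy; elim: n => //= n IH /catsetP [a [b [e Ca]]].
move=> /catsetP [c [d [ed Gc Pd]]]; apply: IH.
have Pn := outside_iter_block (fun w Pw => outside_block_nil (PA w Pw)) (n := n).
have dn := Pn _ Pd; rewrite addn1 in dn.
have := outside_nseq n.+1 v nGy.
rewrite (_ : _ ++ _ = a ++ c ++ d) => [big|]; last by rewrite -ed -e.
rewrite /outside !count_cat -!/(outside _) (outside_star Gc) in big.
case: a Ca e big => [|x' [|//]] /= _ e big; first by rewrite ltnNge dn in big.
case: e => _ e; suff c0 : c = [::] by rewrite e ed c0.
case: c Gc ed e {big} => [//|z c] /star_cons [Gz _] -> e.
by case: n e {Pd Pn dn} => [|n] /= [ez]; [case: nGy|case: nGx]; rewrite ez.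
Qed.

(** If the irreducible closed sets [f s] increase strictly with [s] up to [f t],
    which is contained in one block, then each further block adds at least
    [1 + rk t] to the rank: the sets [iter n block (f s)] lie strictly above the
    [n]-th power of the block and within the next one.  The words witnessing
    strictness start outside [G], so that prefixing them by [x ^ n] leaves them
    outside the smaller set, by [iter_block_cancel]. *)
Section Filling.
Variables (T : Type) (ltT : T -> T -> Prop) (wfT : well_founded ltT).
Variables (f : T -> irr_closed_set (words X)) (t : T) (Z : irr_closed_set (words X)).
Hypothesis f_top : sval (f t) `<=` sval (block nilI).
Hypothesis f_mono : forall r s, ltT r s -> sval (f r) `<=` sval (f s).
Hypothesis f_outside : forall s, exists y v, ~ sval G y /\ sval (f s) (y :: v).
Hypothesis f_strict : forall r s, ltT r s -> exists y v,
  [/\ ~ sval G y, sval (f s) (y :: v) & ~ sval (f r) (y :: v)].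
Hypothesis blocks_Z : forall n, sval (iter n block nilI) `<=` sval Z.

Lemma rk_blocks n :
  ole (omul (oadd (onat 1) (rk wfT t)) (onat n)) (rkW (iter n block nilI)).
Proof.
elim: n => [|n IH]; first by apply/olub_le => -[].
apply: ole_trans (omulS _ (onat n)).1 _.
apply: ole_trans (oadd_le IH (ole_refl _)) _.
have top : sval (iter n block (f t)) `<=` sval (iter n.+1 block nilI).
  by rewrite iterSr; exact: iter_block_le.
apply: ole_trans (rkW_le top).
apply: (@rk_oadd_le _ _ _ _ _ wfT
  (fun s => sval (f s) `<=` sval (block nilI)) (fun s => iter n block (f s))) => //.
  move=> r s sA rs; have rA := subset_trans (f_mono rs) sA; split=> //.
  split; first exact/iter_block_le/f_mono.
  have [y [v [nGy sv nrv]]] := f_strict rs.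
  move=> /(_ (nseq n x ++ y :: v) (iter_block_nseq n sv)).
  by move=> /(iter_block_cancel rA nGy).
move=> s sA; split.
  by apply: iter_block_le => _ ->; exact: irr_nil.
have [y [v [nGy sv]]] := f_outside s.
move=> /(_ (nseq n x ++ y :: v) (iter_block_nseq n sv)).
move=> /(@outside_iter_block n 0) h.
have : outside (nseq n x ++ y :: v) <= n + 0 by apply: h => w /= ->.
by rewrite addn0 leqNgt outside_nseq.
Qed.

Lemma rk_filling : ole (omul (oadd (onat 1) (rk wfT t)) oomega) (rkW Z).
Proof.
by apply: omul_oomega_le => n; apply: ole_trans (rk_blocks n) (rkW_le _).
Qed.

End Filling.

Lemma iter_block_star F n : sval C `<=` sval F -> sval G `<=` sval F ->
  sval (iter n block nilI) `<=` sval (starI F).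
Proof.
move=> CF GF; elim: n => [|n IH]; first by move=> _ ->.
move=> _ /catsetP [a [b [-> /opt_star Ca /catsetP [c [d [-> Gc Pd]]]]]].
apply/star_cat; split; first by move=> y /Ca/CF.
by apply/star_cat; split; [move=> y /Gc/GF|exact: IH].
Qed.

End Powers.

(** Fill the block [C^? G^*], with [C] the closure of a point of [F] outside
    [G], by the sets [C^? P] with [P] an irreducible closed subset of [G^*]. *)
Lemma rk_star_lt F G : closed_lt G F ->
  ole (omul (oadd (onat 1) (rkW (starI G))) oomega) (rkW (starI F)).
Proof.
move=> [GF /existsNP [x /not_implyP [Fx nGx]]].
pose C : irr_closed_set X := exist _ (closure [set x])
  (conj (@closed_closure _ _) (irreducible_closure1 x)).
have Cx : sval C x by exact: subset_closure.
have CF : sval C `<=` sval F.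
  by rewrite /C /= closureE => y; apply; split=> [|_ ->//]; exact: (proj2_sig F).
apply: (@rk_filling C G x Cx nGx _ _ _ (opt_catI C)).
- apply: catset_le => // w Gw; apply/catsetP.
  by exists w, [::]; rewrite cats0.
- by move=> P Q [PQ _]; exact: catset_le.
- move=> P; exists x, [::]; split=> //; apply/catsetP; exists [:: x], [::].
  by split=> //; exact: irr_nil.
- move=> P Q [_ /existsNP [w /not_implyP [Qw nPw]]]; exists x, w; split=> //.
    by apply/catsetP; exists [:: x], w.
  have [cP _] := proj2_sig P.
  move=> /catsetP [a [b [e Ca Pb]]]; apply: nPw.
  case: a e Ca => [|z [|//]] /= e _; last by case: e => _ ->.
  by apply: (closed_suffix (z := [:: x]) cP); rewrite /= e.
- by move=> n; exact: iter_block_star.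
Qed.

(** Fill the block [C^?] by the sets [D^?] with [D] an irreducible closed subset
    of [C]; it is the case of an empty [G]. *)
Lemma rk_star_irr F (C : irr_closed_set X) : sval C `<=` sval F ->
  ole (omul (oadd (onat 1) (rkS C)) oomega) (rkW (starI F)).
Proof.
move=> CF; have [_ [[x Cx] _]] := proj2_sig C.
pose G : closed_set X := exist _ set0 closed0.
have nG y : ~ sval G y by [].
apply: (@rk_filling C G x Cx (nG x) _ _ _ optI).
- move=> w Cw; apply/catsetP; exists w, [::]; rewrite cats0; split=> //.
  by apply/catsetP; exists [::], [::].
- by move=> D E [DE _] [|y [|//]] //= /DE.
- move=> D; have [_ [[y Dy] _]] := proj2_sig D; exists y, [::].
  by split=> //; exact: nG.
- move=> D E [_ /existsNP [y /not_implyP [Ey nDy]]]; exists y, [::].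
  by split=> //; exact: nG.
- by move=> n; apply: iter_block_star.
Qed.

(** The exponents below [ocirc (rkH F)] come from smaller closed sets, except
    that for critical [rkH F] there is one more, [rkH F] itself. *)
Lemma olt_ocirc_rk F d : olt d (ocirc (rkH F)) ->
  (exists2 G, closed_lt G F & ole d (ocirc (rkH G))) \/
  critical (rkH F) /\ ole d (rkH F).
Proof.
have [nc|nc] := pselect (near_critical (rkH F)); last first.
  rewrite (ocircF nc) => dF; have [G GF dG] := olt_rk dF; left; exists G => //.
  exact: ole_trans dG (ocirc_ge _).
rewrite (ocircT nc) => /olt_osucc dF; move: nc => [e [[|n] [ce [Fe eF]]]].
  right; split=> //; have [ee1 ee2] := ce.
  have Fe' := ole_trans Fe (oadd0 e).
  have eF' := ole_trans (oadd_lel e ozero) eF.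
  split; first exact: wexp_ge.
  exact: ole_trans (wexp_le Fe') (ole_trans ee2 eF').
left; have [s1 s2] := oaddS e (onat n).
have [|G GF eG] := @olt_rk _ _ (closed_lt_wf hX) (oadd e (onat n)) F.
  by apply: olt_le_trans eF; apply: olt_le_trans s2; apply/olt_osucc.
exists G => //.
have Ge : ole (rkH G) (oadd e (onat n)).
  apply/olt_osucc; apply: olt_le_trans (rk_lt _ GF) _.
  exact: ole_trans Fe s1.
rewrite ocircT; last by exists e, n.
apply: ole_trans dF _; apply: ole_trans (ole_trans Fe s1) _.
by apply/ole_osucc/olt_osucc.
Qed.

(** The power [wexp c] is the supremum of 1 and the [wexp d * omega], [d < c].
    Exponents coming from a smaller closed set [G] are reached by
    [rk_star_lt] and induction; the extra one at critical ranks is reached by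
    [rk_star_irr], with the irreducible set of [critical_irr]. *)
Lemma wexp_le_rk_star F : sval F !=set0 ->
  ole (wexp (ocirc (rkH F))) (rkW (starI F)).
Proof.
elim/(well_founded_induction (closed_lt_wf hX)): F => F IH Fn0.
have [x Fx] := Fn0.
(* The 1 added here accounts for an empty [G]: [wexp 0] is 1, not 0. *)
have wle G : closed_lt G F ->
    ole (wexp (ocirc (rkH G))) (oadd (onat 1) (rkW (starI G))).
  move=> GF; have [G0|/set0P Gn0] := eqVneq (sval G) set0.
    apply: ole_trans (oadd_lel _ _).
    have := wexp_le (ocirc_le (rkH_set0 hX G0)); rewrite ocirc0.
    by move=> h; apply: ole_trans h _; apply: wexp_lub => // d /olt_zero.
  exact: ole_trans (IH G GF Gn0) (oadd_ler _ _).
apply: wexp_lub.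
  pose N : closed_set X := exist _ set0 closed0.
  have NF : closed_lt N F by split=> // /(_ _ Fx).
  apply: ole_trans (rk_star_lt NF).
  apply: ole_trans (omul_ltS _ (olt_oomega 0)).
  exact: ole_trans (oadd_lel _ _) (oadd_ler _ _).
move=> d /olt_ocirc_rk [[G GF dG]|[crit dF]].
  apply: ole_trans (rk_star_lt GF); apply: omul_le => //.
  exact: ole_trans (wexp_le dG) (wle G GF).
have [C CF FC] := critical_irr crit.
apply: ole_trans (rk_star_irr CF); apply: omul_le => //.
apply: ole_trans (oadd_ler _ _); apply: ole_trans FC.
exact: ole_trans (wexp_le dF) crit.2.
Qed.

Lemma stature_rk (T : closed_set X) : sval T = setT ->
  (stature hX == rkH T)%Ord.
Proof.
move=> TE; split; last exact: (@ole_olub _ rkH T).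
by apply/olub_le => F; apply: rkH_le; rewrite TE.
Qed.

End LowerBound.

Theorem theorem12p13 (X : topologicalType) (hX : noetherian X) :
  ([set: X] !=set0 ->
     (sob (noetherian_words hX) == osucc (oexp oomega (ocirc (stature hX))))%Ord /\
     (rsob (noetherian_words hX) == oexp oomega (ocirc (stature hX)))%Ord) /\
  ([set: X] = set0 -> (sob (noetherian_words hX) == onat 1)%Ord).
Proof.
pose T : closed_set X := exist _ setT closedT.
have [sT Ts] := stature_rk hX (T := T) erefl.
have upper P := ole_trans (rk_words_le hX P (T := T) erefl)
  (wexp_le (ocirc_le Ts)).
split=> [T0|X0].
  have lower := ole_trans (wexp_le (ocirc_le sT)) (wexp_le_rk_star hX (F := T) T0).
  have sobE : (sob (noetherian_words hX) ==
      osucc (wexp (ocirc (stature hX))))%Ord.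
    split; first by apply/oleP => P; apply/olt_osucc; exact: upper.
    by apply/ole_osucc; exists (starI T).
  split=> //; have [s1 s2] := sobE.
  have [p1 p2] := opred_osucc (wexp (ocirc (stature hX))).
  split; first exact: ole_trans (opred_le s1) p1.
  exact: ole_trans p2 (opred_le s2).
have all_nil (w : words X) : w = [::].
  by case: w => // x; have : [set: X] x by []; rewrite X0.
split.
  apply/oleP => P; apply/olt_osucc; apply: rk_le => Q [_].
  by case=> w _; rewrite (all_nil w); exact: irr_nil.
by apply/ole_osucc; exists (starI T); exact: ole0.
Qed.
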